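(* Let $p$ be a prime such that $p \equiv 17 \pmod{24}$ or $p \equiv 23 \pmod{24}$. Then for all integers $k,m \geq 0$ with $p \nmid m$, we have $$dp\left( 6p^{2k+1}m + \frac{15p^{2k+2}+1}{4} \right) \equiv 0 \pmod{4}.$$
   Context: A partition of a positive integer $n$ is a nonincreasing sequence of positive integers (called parts) whose sum is $n$. For $n\ge 0$, $dp(n)$ denotes the number of partitions of $n$ in which every part is either divisible by $4$ or congruent to $\pm 1 \pmod 6$ (with $dp(0)=1$). Equivalently, its generating function is $$\sum_{n=0}^{\infty} dp(n)q^n = \frac{1}{(q;q^6)_\infty (q^5;q^6)_\infty (q^4;q^4)_\infty},$$ where $(a;q)_\infty := (1-a)(1-aq)(1-aq^2)\cdots$. *)

(* Defs.v *)
From mathcomp Require Import all_boot.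

Set Implicit Arguments.
Unset Strict Implicit.
Unset Printing Implicit Defensive.

Definition is_partition (n : nat) (s : seq nat) : bool :=
  [&& sorted geq s, all (ltn 0) s & sumn s == n].

Definition dp_part (x : nat) : bool :=
  [|| 4 %| x, x == 1 %[mod 6] | x == 5 %[mod 6]].

Definition is_dp_partition (n : nat) (s : seq nat) : bool :=
  is_partition n s && all dp_part s.

(* A partition of n has at most n parts, each at most n, so counting inside
   the finite type n.-bseq 'I_n.+1 misses none; see dp_size. *)
Definition dp (n : nat) : nat :=
  #|[set s : n.-bseq 'I_n.+1 | is_dp_partition n (map val s)]|.

Lemma partition_bounds n s :
  is_partition n s -> (size s <= n) && all (fun x => x < n.+1) s.
Proof.
case/and3P=> _ + /eqP<- {n}; elim: s => //= x s IHs /andP[x_gt0 /IHs].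
case/andP=> le_s /allP le_all; rewrite -add1n leq_add //= ltnS leq_addr /=.
by apply/allP=> y /le_all; rewrite !ltnS => /leq_trans; apply; apply: leq_addl.
Qed.

Lemma dp_size n (r : seq (seq nat)) :
  uniq r -> r =i is_dp_partition n -> dp n = size r.
Proof.
move=> Ur rP; rewrite /dp cardE -(size_map (fun s : n.-bseq 'I_n.+1 => map val s)).
apply/perm_size/uniq_perm => // [|s].
  rewrite map_inj_uniq ?enum_uniq // => s t /(inj_map val_inj) eq_st.
  exact: val_inj.
rewrite rP; apply/mapP/idP => [[t + ->]|Ps]; first by rewrite mem_enum inE.
have /andP[/partition_bounds/andP[le_s /allP le_all] _] := Ps.
have le_t : size (map (@inord n) s) <= n by rewrite size_map.
have Ds : s = map val (map (@inord n) s).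
  by rewrite -map_comp map_id_in // => x /le_all x_le /=; rewrite inordK.
by exists (Bseq le_t) => //; rewrite mem_enum inE /= -Ds.
Qed.

(* Main.v *)
Require Import Defs.
From HB Require Import structures.
From mathcomp Require Import all_boot all_algebra all_fingroup all_field cyclic.
From mathcomp Require Import boolp.
From mathcomp Require Import zify ring.

(* Let f_k = prod_(i >= 1) (1 - q^(k i)) and psi(q) = sum_j q^(j(j+1)/2).
   The product for sum_n dp(n) q^n shows that G(q) = sum_n (-1)^n dp(n) q^n
   satisfies G(q) psi(q) = C(q^3) with an explicit product C. Splitting psi
   by exponents mod 3 and multiplying by the two conjugates of psi(q) under
   q -> w q (w^3 = 1), whose product with psi(q) is computed from the infinite
   product for psi, isolates the terms of G of exponent 3n+1: they give
   - theta(-q) times a power series in q^2, where theta(q) = sum_(i in Z) q^(i^2).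
   The odd part of theta(-q) is -2 q psi(q^8), so that
     sum_n dp(6n+4) q^n = 2 psi(q^4) f_3^3 / (f_2 f_1^4)
                        = 2 psi(q^2) psi(q^3)  (mod 4),
   because f_k^2 = f_2k (mod 2). Hence dp(6n+4) is divisible by 4 unless
   8n+5 = 2 a^2 + 3 b^2. Modulo p the number 2 is a square and -3 is not, so
   -6 is a nonresidue and p divides 2 a^2 + 3 b^2 to an even power, whereas it
   divides 8n+5 = 8 p^(2k+1) m + 5 p^(2k+2) exactly 2k+1 times. *)

Set Implicit Arguments.
Unset Strict Implicit.
Unset Printing Implicit Defensive.

Import GRing.Theory.
Local Open Scope ring_scope.

(** * Formal power series over the integers *)

Record fps := Fps { coef : nat -> int }.

Notation "f `[ n ]" := (coef f n) (at level 2, n at level 200, format "f `[ n ]").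

Lemma fpsP (f g : fps) : (forall n, f`[n] = g`[n]) -> f = g.
Proof. by case: f g => [f] [g] /= /funext ->. Qed.

HB.instance Definition _ := gen_eqMixin fps.
HB.instance Definition _ := gen_choiceMixin fps.

Definition fps0 := Fps (fun=> 0).
Definition fps_opp f := Fps (fun n => - f`[n]).
Definition fps_add f g := Fps (fun n => f`[n] + g`[n]).
Definition fps1 := Fps (fun n => (n == 0)%:R).
Definition fps_mul f g := Fps (fun n => \sum_(i < n.+1) f`[i] * g`[n - i]).

Lemma fps_addA : associative fps_add.
Proof. by move=> f g h; apply: fpsP => n /=; rewrite addrA. Qed.
Lemma fps_addC : commutative fps_add.
Proof. by move=> f g; apply: fpsP => n /=; rewrite addrC. Qed.
Lemma fps_add0 : left_id fps0 fps_add.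
Proof. by move=> f; apply: fpsP => n /=; rewrite add0r. Qed.
Lemma fps_addN : left_inverse fps0 fps_opp fps_add.
Proof. by move=> f; apply: fpsP => n /=; rewrite addNr. Qed.

HB.instance Definition _ :=
  GRing.isZmodule.Build fps fps_addA fps_addC fps_add0 fps_addN.

(** Coefficient n of a product involves only coefficients up to n of the factors, so the ring axioms
    for series are inherited from [{poly int}] through truncation. *)
Definition trunc n f : {poly int} := \poly_(i < n) f`[i].

Lemma fps_mulE n m f g : (n < m)%N ->
  (fps_mul f g)`[n] = (trunc m f * trunc m g)`_n.
Proof.
move=> lt_nm; rewrite coefM; apply: eq_bigr => -[i /= le_in] _.
by rewrite !coef_poly !ifT //; lia.
Qed.

Lemma coef_mul_eq (p p' r r' : {poly int}) n :
    (forall i, (i <= n)%N -> p`_i = p'`_i) ->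
    (forall i, (i <= n)%N -> r`_i = r'`_i) ->
  (p * r)`_n = (p' * r')`_n.
Proof.
move=> Ep Er; rewrite !coefM; apply: eq_bigr => -[i /= le_in] _.
by rewrite Ep ?Er //; lia.
Qed.

Lemma trunc_mul n m f g : (n < m)%N ->
  (trunc m (fps_mul f g))`_n = (trunc m f * trunc m g)`_n.
Proof. by move=> lt_nm; rewrite coef_poly lt_nm (fps_mulE _ _ lt_nm). Qed.

Lemma fps_mulA : associative fps_mul.
Proof.
move=> f g h; apply: fpsP => n; rewrite !(@fps_mulE n n.+1) //.
rewrite (@coef_mul_eq _ (trunc n.+1 f) _ (trunc n.+1 g * trunc n.+1 h)) //.
  rewrite mulrA; apply: coef_mul_eq => // i le_in.
  by rewrite trunc_mul.
by move=> i le_in; rewrite trunc_mul.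
Qed.
Lemma fps_mulC : commutative fps_mul.
Proof. by move=> f g; apply: fpsP => n; rewrite !(@fps_mulE n n.+1) // mulrC. Qed.
Lemma fps_mul1 : left_id fps1 fps_mul.
Proof.
move=> f; apply: fpsP => n /=; rewrite big_ord_recl /= mul1r subn0.
by rewrite big1 ?addr0 // => i _; rewrite mul0r.
Qed.
Lemma fps_mulDl : left_distributive fps_mul fps_add.
Proof.
move=> f g h; apply: fpsP => n /=; rewrite -big_split /=.
by apply: eq_bigr => i _; rewrite mulrDl.
Qed.
Lemma fps1_neq0 : fps1 != 0.
Proof. by apply/eqP => /(congr1 (fun f => f`[0])). Qed.

HB.instance Definition _ := GRing.Zmodule_isComNzRing.Build fps
  fps_mulA fps_mulC fps_mul1 fps_mulDl fps1_neq0.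

Lemma fcoefD f g n : (f + g)`[n] = f`[n] + g`[n]. Proof. by []. Qed.
Lemma fcoefN f n : (- f)`[n] = - f`[n]. Proof. by []. Qed.
Lemma fcoef1 n : (1 : fps)`[n] = (n == 0)%:R. Proof. by []. Qed.
Lemma fcoef0 n : (0 : fps)`[n] = 0. Proof. by []. Qed.
Lemma fcoef_sum I (r : seq I) (P : pred I) (F : I -> fps) n :
  (\sum_(i <- r | P i) F i)`[n] = \sum_(i <- r | P i) (F i)`[n].
Proof. exact: (big_morph (fun f : fps => f`[n])). Qed.

Lemma fcoefM (p r : {poly int}) (f g : fps) n :
    (forall i, (i <= n)%N -> f`[i] = p`_i) ->
    (forall i, (i <= n)%N -> g`[i] = r`_i) ->
  (f * g)`[n] = (p * r)`_n.
Proof.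
move=> Ef Eg; rewrite coefM; apply: eq_bigr => -[i /= le_in] _.
by rewrite Ef ?Eg //; lia.
Qed.

Lemma fcoef_trunc m f i : (i < m)%N -> f`[i] = (trunc m f)`_i.
Proof. by rewrite coef_poly => ->. Qed.

Definition q := Fps (fun n => (n == 1)%:R).

Lemma fcoef_qXM k f n :
  (q ^+ k * f)`[n] = if (n < k)%N then 0 else f`[n - k].
Proof.
elim: k f n => [|k IHk] f n; first by rewrite mul1r subn0.
rewrite exprSr -mulrA.
have qM g m : (q * g)`[m] = if m is m'.+1 then g`[m'] else 0.
  rewrite [LHS]/= big_ord_recl /= mul0r add0r; case: m => [|m]; first by rewrite big_ord0.
  rewrite big_ord_recl /= mul1r big1 ?addr0 ?subSS ?subn0 // => i _.
  by rewrite mul0r.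
rewrite IHk; case: ltnP => [lt_nk|le_kn]; first by rewrite ifT //; lia.
rewrite qM; case: ltnP => [lt_nk|lt_kn]; first by rewrite (_ : n - k = 0)%N //; lia.
by rewrite -(subnSK lt_kn).
Qed.

(** * Agreement to order n and q-adic limits *)

Definition eqm n (f g : fps) := forall i, (i < n)%N -> f`[i] = g`[i].

Lemma eqm_sym n f g : eqm n f g -> eqm n g f.
Proof. by move=> fg i lt_in; rewrite fg. Qed.
Lemma eqm_trans n f g h : eqm n f g -> eqm n g h -> eqm n f h.
Proof. by move=> fg gh i lt_in; rewrite fg ?gh. Qed.
Lemma eqmW m n f g : (m <= n)%N -> eqm n f g -> eqm m f g.
Proof. by move=> le_mn fg i lt_im; apply: fg; apply: leq_trans le_mn. Qed.
Lemma eqmP f g : (forall n, eqm n f g) -> f = g.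
Proof. by move=> fg; apply: fpsP => n; apply: (fg n.+1). Qed.
Lemma eqmD n f g f' g' : eqm n f f' -> eqm n g g' -> eqm n (f + g) (f' + g').
Proof. by move=> ff gg i lt_in; rewrite !fcoefD ff ?gg. Qed.
Lemma eqmM n f g f' g' : eqm n f f' -> eqm n g g' -> eqm n (f * g) (f' * g').
Proof.
move=> ff gg i lt_in /=; apply: eq_bigr => -[j /= lt_ji] _.
by rewrite ff ?gg //; lia.
Qed.
Lemma eqmX n f f' k : eqm n f f' -> eqm n (f ^+ k) (f' ^+ k).
Proof. by move=> ff; elim: k => [|k IHk] //; rewrite !exprS; apply: eqmM. Qed.
Lemma eqm_sum n I (r : seq I) (P : pred I) (F F' : I -> fps) :
    (forall i, P i -> eqm n (F i) (F' i)) ->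
  eqm n (\sum_(i <- r | P i) F i) (\sum_(i <- r | P i) F' i).
Proof. by move=> FF; apply: (big_rec2 (eqm n)) => // i f g /FF; apply: eqmD. Qed.
Lemma eqm_prod n I (r : seq I) (P : pred I) (F F' : I -> fps) :
    (forall i, P i -> eqm n (F i) (F' i)) ->
  eqm n (\prod_(i <- r | P i) F i) (\prod_(i <- r | P i) F' i).
Proof. by move=> FF; apply: (big_rec2 (eqm n)) => // i f g /FF; apply: eqmM. Qed.

Lemma eqm0M m n f g : eqm m f 0 -> eqm n g 0 -> eqm (m + n) (f * g) 0.
Proof.
move=> f0 g0 i lt_i /=; rewrite big1 // => -[j /= lt_ji] _.
case: (ltnP j m) => [/f0 ->|le_mj]; first by rewrite mul0r.
by rewrite g0 ?mulr0 //; lia.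
Qed.
Lemma eqm0Ml n f g : eqm n f 0 -> eqm n (f * g) 0.
Proof. by move=> f0; rewrite -[n]addn0; apply: eqm0M. Qed.
Lemma eqm0X n f : eqm 1 f 0 -> eqm n (f ^+ n) 0.
Proof.
move=> f0; elim: n => [|n IHn] //; rewrite exprS -add1n; exact: eqm0M.
Qed.

Lemma eqm_subr n f g : eqm n (f - g) 0 <-> eqm n f g.
Proof.
by split=> fg i /fg; rewrite fcoefD fcoefN fcoef0 => /eqP; rewrite ?subr_eq0 => /eqP //= ->;
  rewrite subrr.
Qed.

(* Coefficient n is read off the first n.+1 terms (factors) only, which is the
   intended value under [summable] ([prodable]) below and junk otherwise. *)
Definition isum (v : nat -> fps) := Fps (fun n => (\sum_(i < n.+1) v i)`[n]).
Definition iprod (u : nat -> fps) := Fps (fun n => (\prod_(i < n.+1) u i)`[n]).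

Definition summable (v : nat -> fps) := forall i, eqm i (v i) 0.
Definition prodable (u : nat -> fps) := forall i, eqm i.+1 (u i) 1.

Lemma eqm_isum v n m : summable v -> (n <= m)%N ->
  eqm n (isum v) (\sum_(i < m) v i).
Proof.
move=> sv le_nm i lt_in; rewrite [LHS]/= -(@subnKC i.+1 m); last by lia.
rewrite big_split_ord fcoefD [X in _ + X]fcoef_sum [X in _ + X]big1 ?addr0 // => j _.
by rewrite (sv _ i) //=; lia.
Qed.

Lemma eqm_iprod u n m : prodable u -> (n <= m)%N ->
  eqm n (iprod u) (\prod_(i < m) u i).
Proof.
move=> pu le_nm i lt_in; rewrite [LHS]/= -(@subnKC i.+1 m); last by lia.
rewrite big_split_ord /= -[X in X`[i]]mulr1; apply: (@eqmM i.+1) => //.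
apply: (@eqm_trans _ _ (\prod_(j < m - i.+1) 1)); first by rewrite big1_eq.
apply: eqm_prod => j _.
by apply/eqm_sym/(eqmW _ (pu _)) => /=; lia.
Qed.

(** By [eqmP], partial sums of arbitrarily large length decide; the freedom in m allows lengths that
    are multiples of a modulus, as in [isum_split]. *)
Lemma isum_lim v f : summable v ->
  (forall n, exists2 m, (n <= m)%N & eqm n f (\sum_(i < m) v i)) -> f = isum v.
Proof.
move=> sv lim; apply: eqmP => n; have [m le_nm /eqm_trans] := lim n; apply.
exact/eqm_sym/eqm_isum.
Qed.

Lemma iprod_lim u f : prodable u ->
  (forall n, exists2 m, (n <= m)%N & eqm n f (\prod_(i < m) u i)) -> f = iprod u.
Proof.
move=> pu lim; apply: eqmP => n; have [m le_nm /eqm_trans] := lim n; apply.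
exact/eqm_sym/eqm_iprod.
Qed.

Lemma eq_isum v v' : v =1 v' -> isum v = isum v'.
Proof. by move=> vv; apply: fpsP => n /=; congr coef; apply: eq_bigr. Qed.
Lemma eq_iprod u u' : u =1 u' -> iprod u = iprod u'.
Proof. by move=> uu; apply: fpsP => n /=; congr coef; apply: eq_bigr. Qed.

Lemma isumD v v' : isum (fun i => v i + v' i) = isum v + isum v'.
Proof. by apply: fpsP => n /=; rewrite big_split. Qed.

Lemma isumMl f v : summable v -> f * isum v = isum (fun i => f * v i).
Proof.
move=> sv; apply: isum_lim => [i|n].
  by rewrite mulrC; apply: eqm0Ml.
by exists n => //; rewrite -mulr_sumr; apply: eqmM => //; apply: eqm_isum.
Qed.

Lemma prodableM u u' : prodable u -> prodable u' -> prodable (fun i => u i * u' i).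
Proof. by move=> pu pu' i; rewrite -[1]mulr1; apply: eqmM. Qed.

Lemma iprodM u u' : prodable u -> prodable u' ->
  iprod (fun i => u i * u' i) = iprod u * iprod u'.
Proof.
move=> pu pu'; apply/esym/iprod_lim => [|n]; first exact: prodableM.
by exists n => //; rewrite big_split /=; apply: eqmM; apply: eqm_iprod.
Qed.

Lemma iprod1 u : u =1 (fun=> 1) -> iprod u = 1.
Proof.
by move=> u1; apply/esym/iprod_lim => [i|n]; [rewrite u1 | exists n => //; rewrite big1].
Qed.

Lemma isum_split m v : summable v ->
  isum v = \sum_(r < m.+1) isum (fun i => v (i * m.+1 + r)%N).
Proof.
move=> sv; apply/esym/isum_lim => // n; exists (n * m.+1)%N; first by lia.
apply: (@eqm_trans _ _ (\sum_(r < m.+1) \sum_(i < n) v (i * m.+1 + r)%N)).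
  by apply: eqm_sum => r _; apply: eqm_isum => // i; apply: eqmW (sv _); lia.
rewrite exchange_big (_ : \sum_(i < n) _ = \sum_(i < n * m.+1) v i) //.
elim: (n) => [|k IHk]; first by rewrite !big_ord0.
by rewrite big_ord_recr IHk mulSn addnC big_split_ord.
Qed.

Lemma iprod_split m u : prodable u ->
  iprod u = \prod_(r < m.+1) iprod (fun i => u (i * m.+1 + r)%N).
Proof.
move=> pu; apply/esym/iprod_lim => // n; exists (n * m.+1)%N; first by lia.
apply: (@eqm_trans _ _ (\prod_(r < m.+1) \prod_(i < n) u (i * m.+1 + r)%N)).
  by apply: eqm_prod => r _; apply: eqm_iprod => // i; apply: eqmW (pu _); lia.
rewrite exchange_big (_ : \prod_(i < n) _ = \prod_(i < n * m.+1) u i) //.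
elim: (n) => [|k IHk]; first by rewrite !big_ord0.
by rewrite big_ord_recr IHk mulSn addnC big_split_ord.
Qed.

(** The inverse is the geometric series in t = 1 - u, which converges because t has no constant
    term. *)
Lemma fps_unit u : eqm 1 u 1 -> exists w, w * u = 1.
Proof.
move=> u1; pose t := 1 - u.
have t0 : eqm 1 t 0 by apply/eqm_subr/eqm_sym.
have st : summable (fun i => t ^+ i) by move=> i; apply: eqm0X.
exists (isum (fun i => t ^+ i)); apply: eqmP => n.
apply: (@eqm_trans _ _ ((\sum_(i < n) t ^+ i) * u)).
  by apply: eqmM => //; apply: eqm_isum.
apply/eqm_subr; rewrite (_ : _ - _ = - t ^+ n); last first.
  have := subrX1 t n; rewrite (_ : t - 1 = - u); last by rewrite /t; ring.
  by move=> E; rewrite mulrC -[u]opprK mulNr -E; ring.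
by rewrite -mulN1r mulrC; apply/eqm0Ml/eqm0X.
Qed.

Lemma fps_mulI u : eqm 1 u 1 -> forall f g, f * u = g * u -> f = g.
Proof.
case/fps_unit=> w wu1 f g E.
by rewrite -[f]mulr1 -[g]mulr1 -wu1 ![w * u]mulrC !mulrA E.
Qed.

Lemma eqm_mulI n u : eqm 1 u 1 ->
  forall f g, eqm n (f * u) (g * u) -> eqm n f g.
Proof.
case/fps_unit=> w wu1 f g E.
by rewrite -[f]mulr1 -[g]mulr1 -wu1 ![w * u]mulrC !mulrA; apply: eqmM.
Qed.

(** For m > 0 this is the substitution of q^m for q. With [sec], which collects the exponents
    congruent to r modulo m, it gives the m-dissection [up_sec]. *)
Definition up m f := Fps (fun n => if (m %| n)%N then f`[n %/ m] else 0).
Definition sec m r f := Fps (fun n => f`[n * m + r]).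

Lemma up_is_zmod m : zmod_morphism (up m).
Proof. by move=> f g; apply: fpsP => n /=; case: ifP; rewrite ?subr0. Qed.
Lemma up_is_monoid m : monoid_morphism (up m.+1).
Proof.
split=> [|f g]; apply: fpsP => n.
  rewrite /=; case: ifP => [/dvdnP[k ->]|]; last by case: n.
  by rewrite mulnK // muln_eq0 orbF.
rewrite (@fcoefM (trunc n.+1 f \Po 'X^(m.+1)) (trunc n.+1 g \Po 'X^(m.+1))).
- rewrite -rmorphM coef_comp_poly_Xn //=; case: ifP => // _.
  by apply: fcoefM => i le_i; apply: fcoef_trunc; have := leq_div n m.+1; lia.
- by move=> i le_i; rewrite coef_comp_poly_Xn //= -fcoef_trunc // ltnS (leq_trans (leq_div _ _)).
- by move=> i le_i; rewrite coef_comp_poly_Xn //= -fcoef_trunc // ltnS (leq_trans (leq_div _ _)).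
Qed.
HB.instance Definition _ m := GRing.isZmodMorphism.Build fps fps (up m) (up_is_zmod m).
HB.instance Definition _ m := GRing.isMonoidMorphism.Build fps fps (up m.+1) (up_is_monoid m).

Lemma sec_is_zmod m r : zmod_morphism (sec m r).
Proof. by move=> f g; apply: fpsP. Qed.
HB.instance Definition _ m r := GRing.isZmodMorphism.Build fps fps (sec m r) (sec_is_zmod m r).

Lemma eqm_up m n f g : eqm n f g -> eqm n (up m.+1 f) (up m.+1 g).
Proof. by move=> fg i lt_in /=; rewrite fg // (leq_ltn_trans (leq_div _ _)). Qed.

Lemma sec_qX_up m r s f : (r < m)%N -> (s < m)%N ->
  sec m r (q ^+ s * up m f) = if r == s then f else 0.
Proof.
move=> lt_rm lt_sm; apply: fpsP => n; rewrite [LHS]fcoef_qXM.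
have m0 : (0 < m)%N by lia.
case: eqVneq => [->|neq_rs].
  by rewrite ifN ?addnK /= ?dvdn_mull // ?mulnK //; lia.
case: ltnP => //= le_s; case: ifP => // /dvdnP[k Ek]; exfalso.
have {}Ek : (n * m + r = k * m + s)%N by lia.
by move/(congr1 (modn^~ m)): Ek; rewrite !modnMDl !modn_small // => /eqP; apply/negP.
Qed.

Lemma up_sec m f : f = \sum_(r < m.+1) q ^+ r * up m.+1 (sec m.+1 r f).
Proof.
apply: fpsP => n; rewrite fcoef_sum.
rewrite (bigD1 (Ordinal (ltn_pmod n (ltn0Sn m)))) // big1.
  rewrite fcoef_qXM ifN; last by rewrite -leqNgt leq_mod.
  have E : (n - n %% m.+1 = n %/ m.+1 * m.+1)%N by rewrite {1}(divn_eq n m.+1) addnK.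
  by rewrite /= E dvdn_mull // mulnK // -divn_eq addr0.
move=> r neq_r; rewrite fcoef_qXM; case: ltnP => //= le_rn.
case: ifP => // /dvdnP[k Ek]; case/eqP: neq_r; apply: val_inj => /=.
by rewrite -(subnK le_rn) Ek modnMDl modn_small.
Qed.

Lemma up_isum m v : summable v -> up m.+1 (isum v) = isum (fun i => up m.+1 (v i)).
Proof.
move=> sv; apply: isum_lim => [i|n].
  by rewrite -(raddf0 (up m.+1)); apply: eqm_up.
by exists n => //; rewrite -raddf_sum; apply/eqm_up/eqm_isum.
Qed.
Lemma up_iprod m u : prodable u -> up m.+1 (iprod u) = iprod (fun i => up m.+1 (u i)).
Proof.
move=> pu; apply: iprod_lim => [i|n].
  by rewrite -(rmorph1 (up m.+1)); apply: eqm_up.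
by exists n => //; rewrite -rmorph_prod; apply/eqm_up/eqm_iprod.
Qed.

Lemma up_q m : up m.+1 q = q ^+ m.+1.
Proof.
apply: fpsP => n; rewrite -[q ^+ _]mulr1 fcoef_qXM /=.
case: ltnP => [lt_nm|le_mn].
  case: ifP => // _; rewrite divn_small //.
case: ifP => [/dvdnP[k Ek]|ndvd]; rewrite ?Ek ?mulnK //.
  by congr (nat_of_bool _)%:R; apply/eqP/eqP; nia.
by case: eqP => //= E; move: ndvd; rewrite (_ : n = m.+1) ?dvdnn //; lia.
Qed.

(** * The Jacobi triple product *)

(** Takes the place of |z| < 1 in analysis: it makes the infinite products and theta series below
    converge. *)
Definition small f := eqm 1 f 0.

Lemma smallMl f g : small f -> small (f * g).
Proof. exact: eqm0Ml. Qed.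
Lemma smallMr f g : small g -> small (f * g).
Proof. by rewrite mulrC; apply: smallMl. Qed.
Lemma smallX f n : small f -> (0 < n)%N -> small (f ^+ n).
Proof. by case: n => // n f0 _; rewrite exprS; apply: smallMl. Qed.
Lemma smallN f : small f -> small (- f).
Proof. by rewrite -mulN1r; apply: smallMr. Qed.
Lemma small_q : small q.
Proof. by case. Qed.

(** The q-Pochhammer symbol (x; z)_infinity. *)
Definition poch x z := iprod (fun i => 1 - x * z ^+ i).

Lemma eqm_sub1 n f : eqm n f 0 -> eqm n (1 - f) 1.
Proof. by move=> f0; apply/eqm_subr; rewrite addrAC subrr add0r -mulN1r mulrC; apply: eqm0Ml. Qed.

Lemma poch_prodable x z : small x -> small z -> prodable (fun i => 1 - x * z ^+ i).
Proof. by move=> x0 z0 i; apply/eqm_sub1; rewrite -add1n; apply/eqm0M/eqm0X. Qed.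

Lemma poch_small1 x z : small x -> small z -> eqm 1 (poch x z) 1.
Proof.
move=> x0 z0; apply: (eqm_trans (eqm_iprod (poch_prodable x0 z0) (leqnn 1))).
by rewrite big_ord1; exact: (@poch_prodable _ _ x0 z0 0%N).
Qed.

Lemma poch_split m x z : small x -> small z ->
  poch x z = \prod_(r < m.+1) poch (x * z ^+ r) (z ^+ m.+1).
Proof.
move=> x0 z0; rewrite [LHS](iprod_split m (poch_prodable x0 z0)).
apply: eq_bigr => r _; apply: eq_iprod => i.
by rewrite -mulrA exprD mulnC exprM [z ^+ r * _]mulrC.
Qed.

Lemma poch_split2 x z : small x -> small z ->
  poch x z = poch x (z ^+ 2) * poch (x * z) (z ^+ 2).
Proof. by move=> x0 z0; rewrite (poch_split 1) // !big_ord_recr big_ord0 /= mul1r mulr1 expr1. Qed.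

Lemma poch_split3 x z : small x -> small z ->
  poch x z = poch x (z ^+ 3) * poch (x * z) (z ^+ 3) * poch (x * z ^+ 2) (z ^+ 3).
Proof. by move=> x0 z0; rewrite (poch_split 2) // !big_ord_recr big_ord0 /= mul1r mulr1 expr1. Qed.

Lemma pochN x z : small x -> small z -> poch (- x) z * poch x z = poch (x ^+ 2) (z ^+ 2).
Proof.
move=> x0 z0; rewrite -iprodM; [|exact: poch_prodable (smallN _) _|exact: poch_prodable].
by apply: eq_iprod => i; rewrite -exprM mulnC exprM; ring.
Qed.

(* [jcoef z n i] is the Gaussian binomial (2n choose n + i) in base z, through
   the recursion that multiplication by (1 + x z^n) (1 + y z^n), z = x y,
   induces on the coefficients of the finite triple product. *)
Fixpoint jcoef (z : fps) (n i : nat) : fps :=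
  match n, i with
  | 0, 0 => 1
  | 0, _.+1 => 0
  | n.+1, 0 => (1 + z ^+ (2 * n).+1) * jcoef z n 0 + 2 * z ^+ n.+1 * jcoef z n 1
  | n.+1, i.+1 => (1 + z ^+ (2 * n).+1) * jcoef z n i.+1
      + z ^+ (n - i) * jcoef z n i + z ^+ (n + i).+2 * jcoef z n i.+2
  end.

Lemma jcoef_gt z n i : (n < i)%N -> jcoef z n i = 0.
Proof.
elim: n i => [|n IHn] [|i] //= lt_ni; rewrite !IHn //; [ring | lia | lia].
Qed.

Lemma jcoef_diag z n : jcoef z n n = 1.
Proof. by elim: n => //= n IHn; rewrite IHn !jcoef_gt // subnn; ring. Qed.

Definition pochn z n : fps := \prod_(i < n) (1 - z ^+ i.+1).

Lemma pochnS z n : pochn z n.+1 = pochn z n * (1 - z ^+ n.+1).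
Proof. by rewrite /pochn big_ord_recr. Qed.

(** Induction on n through the recursion of [jcoef]. The quotient of (z; z)_2n by (z; z)_(n-i) (z;
    z)_(n+i) is kept without division. *)
Lemma jcoefE z n i : (i <= n)%N ->
  jcoef z n i * pochn z (n - i) * pochn z (n + i) = pochn z (2 * n).
Proof.
elim: n i => [|n IHn] i.
  by case: i => // _; rewrite /= /pochn big_ord0; ring.
(* The hypothesis at k + 1 multiplied by 1 - z^(n-k), so that it also covers k = n, where both sides
   vanish. *)
have IHn1 k : (k <= n)%N -> jcoef z n k.+1 * pochn z (n - k) * pochn z (n + k).+1
    = pochn z (2 * n) * (1 - z ^+ (n - k)).
  rewrite leq_eqVlt => /predU1P[->|lt_kn]; first by rewrite jcoef_gt // subnn; ring.
  rewrite -(IHn k.+1) // -(subnSK lt_kn) pochnS addnS; ring.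
have -> : (2 * n.+1 = (2 * n).+2)%N by lia.
case: i => [_|i le_in].
  rewrite [jcoef _ _ _]/= subn0 addn0 !pochnS.
  have := IHn 0 isT; have := IHn1 0 isT; rewrite subn0 addn0 !pochnS => E1 E0.
  rewrite -E0 !exprS [(2 * n)%N]mulnC exprM.
  move: E1; rewrite -E0 => E1.
  transitivity ((1 - z * z ^+ n) *
    (((1 + z * z ^+ n ^+ 2) * jcoef z n 0 * pochn z n ^+ 2 * (1 - z * z ^+ n))
     + 2 * (z * z ^+ n) * (jcoef z n 1 * pochn z n * (pochn z n * (1 - z ^+ n.+1))))).
    by rewrite [z ^+ n.+1]exprS; ring.
  by rewrite E1; ring.
rewrite subSS addSn addnS.
have := le_in; rewrite ltnS leq_eqVlt => /predU1P[->|lt_in].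
  by rewrite jcoef_diag subnn mul2n -addnn /pochn big_ord0; ring.
have E0 := IHn i (ltnW lt_in); have E1 := IHn1 i (ltnW lt_in).
have E2 := IHn1 i.+1 lt_in.
set d := (n - i.+1)%N; have Ed : (n - i = d.+1)%N by lia.
rewrite [jcoef _ _ _]/= !pochnS Ed.
rewrite Ed in E0 E1; rewrite -/d addnS in E2.
have {}E2 : jcoef z n i.+2 * pochn z d.+1 * pochn z (n + i).+2
    = pochn z (2 * n) * (1 - z ^+ d) * (1 - z ^+ d.+1).
  by rewrite pochnS -E2; ring.
(* Each of the three terms of the recursion is grouped into a multiple of [pochn z (2 * n)]. Writing
   n = i + d + 1 then removes all subtractions from the exponents, and a polynomial identity
   remains. *)
transitivity ((1 + z ^+ (2 * n).+1) * (jcoef z n i.+1 * pochn z d.+1 * pochn z (n + i).+1)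
    * (1 - z ^+ (n + i).+2)
  + z ^+ d.+1 * (jcoef z n i * pochn z d.+1 * pochn z (n + i))
    * (1 - z ^+ (n + i).+1) * (1 - z ^+ (n + i).+2)
  + z ^+ (n + i).+2 * (jcoef z n i.+2 * pochn z d.+1 * pochn z (n + i).+2)).
  by rewrite !pochnS; ring.
rewrite E0 E1 E2.
have -> : (n = i + d.+1)%N by lia.
clearbody d.
rewrite (_ : ((2 * (i + d.+1)).+2 = i + i + d + d + 4)%N); last by lia.
rewrite (_ : ((2 * (i + d.+1)).+1 = i + i + d + d + 3)%N); last by lia.
rewrite (_ : ((i + d.+1 + i).+2 = i + i + d + 3)%N); last by lia.
rewrite (_ : ((i + d.+1 + i).+1 = i + i + d + 2)%N); last by lia.
by rewrite !exprD !exprS; ring.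
Qed.

(** The term of index i in Ramanujan's sum f(x, y) over all integers; the term of index -i is
    [jterm y x i]. *)
Definition jterm (x y : fps) i := x ^+ 'C(i.+1, 2) * y ^+ 'C(i, 2).

Lemma jterm0 x y : jterm x y 0 = 1.
Proof. by rewrite /jterm; ring. Qed.

Lemma bin2S i : 'C(i.+1, 2) = ('C(i, 2) + i)%N.
Proof. by rewrite binS bin1. Qed.

Lemma jtermS x y i : jterm x y i.+1 = jterm x y i * x * (x * y) ^+ i.
Proof. by rewrite /jterm (bin2S i.+1) {2}(bin2S i) !exprD exprMn exprS; ring. Qed.

(** Induction on n with M fixed: the terms beyond n vanish by [jcoef_gt], so the range of summation
    need not change. *)
Lemma finite_jtp x y n M : (n <= M)%N -> let z := x * y in
  \prod_(i < n) ((1 + x * z ^+ i) * (1 + y * z ^+ i)) =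
  jcoef z n 0 + \sum_(i < M) jcoef z n i.+1 * (jterm x y i.+1 + jterm y x i.+1).
Proof.
move=> le_nM z; have Ez : z = x * y by []; clearbody z.
elim: n => [|n IHn] in le_nM *.
  rewrite big_ord0 big1 ?addr0 // => i _; exact: mul0r.
rewrite big_ord_recr IHn /=; last exact: ltnW.
(* Multiplication by x z^n raises the index on the x side and lowers it on the y side; y z^n does
   the opposite. [up_] and [dn_] reindex the sums accordingly. Index 0 is reached from both sides,
   hence the 2 in [jcoef]. *)
have up_ u (X : fps) : u 0%N = 1 -> (forall i, (i <= n)%N -> X * u i = z ^+ (n - i) * u i.+1) ->
    X * jcoef z n 0 + X * \sum_(i < M) jcoef z n i.+1 * u i.+1 =
    \sum_(i < M) z ^+ (n - i) * jcoef z n i * u i.+1.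
  move=> u0 uS; have -> : X * jcoef z n 0 + X * \sum_(i < M) jcoef z n i.+1 * u i.+1
      = X * \sum_(i < M.+1) jcoef z n i * u i.
    by rewrite big_ord_recl u0 mulr1 mulrDr.
  rewrite big_ord_recr /= jcoef_gt // mul0r addr0 mulr_sumr; apply: eq_bigr => i _.
  case: (leqP i n) => [le_in|lt_ni]; last by rewrite jcoef_gt //; ring.
  by rewrite mulrCA uS //; ring.
have dn_ u (X : fps) : u 0%N = 1 -> (forall i, X * u i.+1 = z ^+ (n + i).+1 * u i) ->
    X * \sum_(i < M) jcoef z n i.+1 * u i.+1 = z ^+ n.+1 * jcoef z n 1
      + \sum_(i < M) z ^+ (n + i).+2 * jcoef z n i.+2 * u i.+1.
  case: M le_nM {IHn up_} => // M le_nM u0 uS; rewrite mulr_sumr big_ord_recl /=.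
  rewrite mulrCA uS addn0 u0 mulr1 [in RHS]big_ord_recr /= [jcoef z n M.+2]jcoef_gt; last by lia.
  rewrite mulr0 mul0r addr0 [X in X + _]mulrC; congr (_ + _); apply: eq_bigr => i _.
  by rewrite mulrCA uS /bump /= add1n addnS; ring.
have uX i : (i <= n)%N -> x * z ^+ n * jterm x y i = z ^+ (n - i) * jterm x y i.+1.
  by move=> le_in; rewrite jtermS -Ez -{1}(subnK le_in) exprD; ring.
have vY i : (i <= n)%N -> y * z ^+ n * jterm y x i = z ^+ (n - i) * jterm y x i.+1.
  by move=> le_in; rewrite jtermS [y * x]mulrC -Ez -{1}(subnK le_in) exprD; ring.
have vX i : x * z ^+ n * jterm y x i.+1 = z ^+ (n + i).+1 * jterm y x i.
  by rewrite jtermS [y * x]mulrC -Ez exprS exprD; move: (z ^+ n) (z ^+ i) => a b; rewrite Ez; ring.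
have uY i : y * z ^+ n * jterm x y i.+1 = z ^+ (n + i).+1 * jterm x y i.
  by rewrite jtermS -Ez exprS exprD; move: (z ^+ n) (z ^+ i) => a b; rewrite Ez; ring.
have -> : (1 + x * z ^+ n) * (1 + y * z ^+ n) = 1 + z ^+ (2 * n).+1 + x * z ^+ n + y * z ^+ n.
  by rewrite exprS mul2n -addnn exprD; move: (z ^+ n) => a; rewrite Ez; ring.
have := up_ _ _ (jterm0 x y) uX; have := up_ _ _ (jterm0 y x) vY.
have := dn_ _ _ (jterm0 x y) uY; have := dn_ _ _ (jterm0 y x) vX.
set U := \sum_(i < M) jcoef z n i.+1 * jterm x y i.+1.
set V := \sum_(i < M) jcoef z n i.+1 * jterm y x i.+1.
set U1 := \sum_(i < M) z ^+ (n - i) * _ * jterm x y i.+1.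
set V1 := \sum_(i < M) z ^+ (n - i) * _ * jterm y x i.+1.
set U2 := \sum_(i < M) z ^+ (n + i).+2 * _ * jterm x y i.+1.
set V2 := \sum_(i < M) z ^+ (n + i).+2 * _ * jterm y x i.+1.
move=> EV2 EU2 EV1 EU1.
have -> : \sum_(i < M) jcoef z n i.+1 * (jterm x y i.+1 + jterm y x i.+1) = U + V.
  by rewrite -big_split; apply: eq_bigr => i _; rewrite mulrDr.
transitivity ((1 + z ^+ (2 * n).+1) * jcoef z n 0 + 2 * z ^+ n.+1 * jcoef z n 1
  + ((1 + z ^+ (2 * n).+1) * (U + V) + (U1 + V1) + (U2 + V2))); last first.
  congr (_ + _); rewrite -!big_split mulr_sumr -!big_split /=.
  by apply: eq_bigr => i _; ring.
move: EV2 EU2 EV1 EU1; move: (x * z ^+ n) (y * z ^+ n) (z ^+ (2 * n).+1) => X Y Z E1 E2 E3 E4.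
transitivity ((1 + Z) * (jcoef z n 0 + (U + V)) + (X * jcoef z n 0 + X * U)
  + (Y * jcoef z n 0 + Y * V) + X * V + Y * U); first ring.
by rewrite E1 E2 E3 E4; ring.
Qed.

(** Ramanujan's f(x, y), the terms of index i and -i-1 being paired because they share the power of
    x. *)
Definition theta x y := isum (fun i => x ^+ 'C(i.+1, 2) * (y ^+ 'C(i, 2) + y ^+ 'C(i.+2, 2))).

Lemma small_jterm x y i : small x -> eqm i (jterm x y i) 0.
Proof.
move=> x0; apply: eqm0Ml; apply: eqmW (@eqm0X 'C(i.+1, 2) _ x0).
by rewrite bin2S leq_addl.
Qed.

Lemma theta_jterm x y : theta x y = isum (fun i => jterm x y i + jterm y x i.+1).
Proof. by apply: eq_isum => i; rewrite /jterm mulrDr [y ^+ 'C(i.+2, 2) * _]mulrC. Qed.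

Lemma summable_jterm x y : small x -> small y ->
  summable (fun i => jterm x y i + jterm y x i.+1).
Proof.
move=> x0 y0 i; rewrite -[0]addr0; apply: eqmD; first exact: small_jterm.
by apply: eqmW (@small_jterm y x i.+1 y0).
Qed.

(** In [jcoefE] each finite product agrees with (z; z)_infinity at least through order n - i, so the
    Gaussian binomial tends to 1 / (z; z)_infinity. *)
Lemma jcoef_lim z n i : small z -> (i <= n)%N ->
  eqm (n - i).+1 (poch z z * jcoef z n i) 1.
Proof.
move=> z0 le_in.
have pE m k : (k <= m)%N -> eqm k.+1 (pochn z m) (poch z z).
  move=> le_km; have -> : pochn z m = \prod_(i < m) (1 - z * z ^+ i).
    by apply: eq_bigr => j _; rewrite exprS.
  have lek : (k.+1 <= m.+1)%N by [].
  apply: eqm_sym; apply: eqm_trans (eqm_iprod (poch_prodable z0 z0) lek) _.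
  rewrite big_ord_recr -[X in eqm _ _ X]mulr1; apply: eqmM => //=.
  by apply: eqmW (@poch_prodable _ _ z0 z0 m).
apply: (eqm_mulI (poch_small1 z0 z0)); rewrite mul1r.
apply: (@eqm_trans _ _ (pochn z (2 * n))); last by apply: pE; lia.
rewrite -(jcoefE z le_in) [poch z z * _]mulrC.
by apply/eqm_sym/eqmM; [apply: eqmM => //; apply: pE | apply: pE; lia].
Qed.

Lemma jacobi_triple_product x y : small x -> small y ->
  theta x y = poch (- x) (x * y) * poch (- y) (x * y) * poch (x * y) (x * y).
Proof.
move=> x0 y0; set z := x * y; have z0 : small z by apply: smallMl.
have [nx0 ny0] := (smallN x0, smallN y0).
apply: eqmP => n; rewrite theta_jterm.
apply: eqm_trans (eqm_isum (summable_jterm x0 y0) (leqnSn n)) _.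
rewrite big_split /= big_ord_recl jterm0 [\sum_(i < n.+1) jterm y x _]big_ord_recr /=.
rewrite addrA -[X in eqm _ _ X]addr0; apply: eqmD; last by apply: eqmW (@small_jterm y x n.+1 y0).
rewrite -addrA -big_split /=.
apply: (@eqm_trans _ _ (poch z z * \prod_(i < n) ((1 + x * z ^+ i) * (1 + y * z ^+ i)))).
  rewrite (finite_jtp x y (leqnn n)) mulrDr mulr_sumr; apply: eqmD.
    by apply: eqm_sym; have := jcoef_lim z0 (leq0n n); apply: eqmW; lia.
  apply: eqm_sum => -[i /= lt_in] _; apply/eqm_sym/eqm_subr.
  rewrite (_ : _ - _ = (poch z z * jcoef z n i.+1 - 1) * (jterm x y i.+1 + jterm y x i.+1));
    last by rewrite -/z; ring.
  (* The coefficient is only known to order n - (i + 1), but the terms of index i + 1 have order at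
     least i + 1, which makes up the difference. *)
  rewrite -{1}(subnK lt_in); apply: eqm0M.
    by apply/eqm_subr; have := jcoef_lim z0 lt_in; apply: eqmW; lia.
  by rewrite -[0]addr0; apply: eqmD; apply: small_jterm.
rewrite mulrC; apply: eqmM => //; rewrite big_split /=; apply: eqmM.
  apply: eqm_sym; apply: eqm_trans (eqm_iprod (poch_prodable nx0 z0) (leqnn n)) _.
  by apply: eqm_prod => i _; rewrite mulNr opprK.
apply: eqm_sym; apply: eqm_trans (eqm_iprod (poch_prodable ny0 z0) (leqnn n)) _.
by apply: eqm_prod => i _; rewrite mulNr opprK.
Qed.

(** * Product forms of psi and of the theta series *)

Lemma poch_odd z : small z -> poch (- z) (z ^+ 2) * poch z (z ^+ 2) = poch (z ^+ 2) (z ^+ 4).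
Proof. by move=> z0; rewrite (pochN z0 (smallX z0 (ltn0Sn 1))) -exprM. Qed.

(** [euler (q ^+ k)] is the product f_k. *)
Definition euler z := poch z z.
(** Ramanujan's psi in the form f(z^3, z), to which the triple product applies; [psi_tri] recovers
    the sum over triangular numbers. *)
Definition psi z := theta (z ^+ 3) z.

Lemma euler_split2 z : small z -> euler z = poch z (z ^+ 2) * euler (z ^+ 2).
Proof. exact: (fun z0 => poch_split2 z0 z0). Qed.

Lemma euler_split4 z : small z -> euler (z ^+ 2) = poch (z ^+ 2) (z ^+ 4) * euler (z ^+ 4).
Proof. by move=> z0; rewrite (euler_split2 (smallX z0 (ltn0Sn 1))) -exprM. Qed.

Lemma psiE z : small z -> psi z = poch (- z) (z ^+ 2) * euler (z ^+ 4).
Proof.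
move=> z0; have z2 := smallX z0 (ltn0Sn 1); have z3 := smallX z0 (ltn0Sn 2).
rewrite (poch_split2 (smallN z0) z2) mulNr -exprS -exprM.
by rewrite /psi (jacobi_triple_product z3 z0) -exprSr [X in X * _]mulrC.
Qed.

Lemma psi_euler z : small z -> psi z * euler z = euler (z ^+ 2) ^+ 2.
Proof.
move=> z0; rewrite (psiE z0) (euler_split2 z0) [RHS]expr2 {2}(euler_split4 z0) -(poch_odd z0).
by move: (poch (- z) _) (poch z _) (euler _) (euler _) => a b c d; ring.
Qed.

Lemma poch_odd_euler z : small z ->
  poch (- z) (z ^+ 2) * euler z * euler (z ^+ 4) = euler (z ^+ 2) ^+ 2.
Proof. by move=> z0; rewrite -(psi_euler z0) (psiE z0) mulrAC. Qed.

Lemma theta_minus_euler z : small z -> theta (- z) (- z) * euler (z ^+ 2) = euler z ^+ 2.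
Proof.
move=> z0; have nz0 := smallN z0.
rewrite (jacobi_triple_product nz0 nz0) opprK mulrNN -expr2 (euler_split2 z0).
by rewrite -/(euler (z ^+ 2)); move: (poch z _) (euler _) => a b; ring.
Qed.

(** The triple product in base z^3 has the factors (-z; z^3) and (-z^2; z^3); [pochN] pairs them
    with the matching factors of f_1 and passes to base z^6. *)
Lemma theta_cubic z : small z ->
  theta (z ^+ 2) z * euler z * euler (z ^+ 6) = euler (z ^+ 2) * euler (z ^+ 3) ^+ 2.
Proof.
move=> z0; have z2 := smallX z0 (ltn0Sn 1); have z3 := smallX z0 (ltn0Sn 2).
rewrite (jacobi_triple_product z2 z0) -exprSr /euler (poch_split3 z0 z0) (poch_split3 z2 z2).
rewrite -exprM -!exprD -expr2 -exprS -exprM.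
move: (pochN z0 z3) (pochN z2 z3); rewrite -!exprM => <- <-.
rewrite -[z ^+ 2 * _]exprD.
move: (poch (- z) _) (poch z _) (poch (- z ^+ 2) _) (poch (z ^+ 2) _) => a b c d.
move: (poch (z ^+ 3) _) (poch (z ^+ 6) _) => e f; ring.
Qed.

(** * The generating function of dp *)

(** The sign in -q produces the weights (-1)^n and turns the odd factors into 1 + q^j, which are
    factors of psi(q). *)
Definition dp_factor i : fps := if dp_part i.+1 then 1 - (- q) ^+ i.+1 else 1.

Lemma dp_factor_prodable : prodable dp_factor.
Proof.
move=> i; rewrite /dp_factor; case: ifP => // _; apply: eqm_sub1.
exact/eqm0X/smallN/small_q.
Qed.

Definition bounded_dp m n s := is_dp_partition n s && all (leq^~ m) s.

Lemma bounded_dp0 n s : bounded_dp 0 n s = (n == 0) && (s == [::]).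
Proof.
rewrite /bounded_dp /is_dp_partition /is_partition.
case: s => [|[|x] s] /=; rewrite ?andbF //.
by rewrite andbT eq_sym !andbT.
Qed.

(** Parts are nonincreasing, so a part m + 1 must occur at the head, where it can be removed. *)
Lemma bounded_dpS m n s : bounded_dp m.+1 n s =
  bounded_dp m n s ||
  [&& dp_part m.+1, m.+1 <= n, ohead s == Some m.+1 & bounded_dp m.+1 (n - m.+1) (behead s)]%N.
Proof.
rewrite /bounded_dp /is_dp_partition /is_partition.
case: s => [|x s] /=; first by rewrite !andbF orbF.
have geq_tr : transitive geq by move=> a b c /= ab bc; apply: leq_trans ab.
rewrite (path_sortedE geq_tr) -[Some x == _]/(x == m.+1) [(x <= m.+1)%N]leq_eqVlt ltnS.
case: (eqVneq x m.+1) => [->|neq_x] /=; last first.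
  rewrite !andbF orbF; case le_xm: (x <= m)%N; rewrite ?andbF //=.
  case all_s: (all (geq x) s) => //=; congr (_ && _).
  transitivity true; [|apply/esym]; apply: sub_all all_s => y /= le_yx; lia.
rewrite ltnn !andbF /= andbA.
have -> : (m.+1 + sumn s == n)%N = (m.+1 <= n)%N && (sumn s == n - m.+1)%N by apply/eqP/andP; lia.
case: (dp_part m.+1); last by rewrite ?andbF.
case: (m.+1 <= n)%N; last by rewrite ?andbF.
have -> : all (geq m.+1) s = all (leq^~ m.+1) s by [].
by case: (all (leq^~ m.+1) s); rewrite ?andbF //= !andbT.
Qed.

(** Multiplying W by the last factor gives the inverse of the previous product, hence a recursion
    for the coefficients of W that follows the two cases of [bounded_dpS]. An explicit list is built
    so that [dp_size] applies. *)
Lemma finite_dp_gf m (W : fps) n : W * \prod_(i < m) dp_factor i = 1 ->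
  exists r : seq (seq nat), [/\ uniq r, r =i bounded_dp m n
                              & W`[n] = (-1) ^+ n * (size r)%:R].
Proof.
elim: m W n => [|m IHm] W n.
  rewrite big_ord0 mulr1 => ->; exists (if n == 0%N then [:: [::]] else [::]); split.
  - by case: ifP.
  - by move=> s; rewrite [RHS]bounded_dp0; case: ifP; rewrite // inE.
  - by rewrite fcoef1; case: n => //= n; rewrite mulr0.
rewrite big_ord_recr mulrCA mulrC => Wm.
elim/ltn_ind: n => n IHn; have [r1 [U1 mem1 E1]] := IHm _ n Wm.
have EW : (W * dp_factor m)`[n] =
    W`[n] - (if dp_part m.+1 && (m.+1 <= n)%N then (-1) ^+ m.+1 * W`[n - m.+1] else 0).
  rewrite /dp_factor; case: ifP => _; last by rewrite mulr1 subr0.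
  have -> : W * (1 - (- q) ^+ m.+1) = W - (-1) ^+ m.+1 * (q ^+ m.+1 * W).
    by rewrite [(- q) ^+ _]exprNn; ring.
  rewrite fcoefD fcoefN -signr_odd; congr (_ - _).
  have -> : ((-1) ^+ odd m.+1 * (q ^+ m.+1 * W))`[n] = (-1) ^+ odd m.+1 * (q ^+ m.+1 * W)`[n].
    by case: (odd _); rewrite ?expr0 ?expr1 ?mul1r // !mulN1r.
  by rewrite fcoef_qXM signr_odd [(n < m.+1)%N]ltnNge; case: (m < n)%N => /=; rewrite ?mulr0.
have [cond|ncond] := boolP (dp_part m.+1 && (m.+1 <= n)%N); last first.
  exists r1; split=> //; last by rewrite -E1 EW (negPf ncond) subr0.
  move=> s; rewrite mem1 [RHS]bounded_dpS; move: ncond.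
  by case: (dp_part _) => [/= /negPf->|_]; rewrite /= ?andbF orbF.
have [dpm le_mn] := andP cond.
have [|r2 [U2 mem2 E2]] := IHn (n - m.+1)%N; first by lia.
exists (r1 ++ map (cons m.+1) r2); split.
- rewrite cat_uniq U1 map_inj_uniq ?U2 ?andbT //; last by move=> ? ? [].
  apply/hasPn => _ /mapP[s _ ->]; rewrite mem1; apply/negP => /andP[_ /=].
  by rewrite ltnn.
- move=> s; rewrite mem_cat mem1 [RHS]bounded_dpS dpm le_mn /=; congr (_ || _).
  case: s => [|x s] /=; first by apply/negP => /mapP[].
  rewrite -[Some x == _]/(x == m.+1) -[bounded_dp _ _ s]mem2.
  apply/mapP/andP => [[t ? [-> ->]]|[/eqP-> ?]] //.
  by exists s.
- have -> : W`[n] = (W * dp_factor m)`[n] + (-1) ^+ m.+1 * W`[n - m.+1] by rewrite EW cond subrK.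
  by rewrite E1 E2 size_cat size_map natrD mulrDr mulrA -exprD subnKC.
Qed.

Definition dp_gf := Fps (fun n => (-1) ^+ n * (dp n)%:R).

Lemma dp_gfE : dp_gf * iprod dp_factor = 1.
Proof.
have pu := dp_factor_prodable.
have u1 : eqm 1 (iprod dp_factor) 1.
  by apply: (eqm_trans (eqm_iprod pu (leqnn 1))); rewrite big_ord1; apply: (pu 0%N).
have [W EW] := fps_unit u1; suff -> : dp_gf = W by [].
apply: fpsP => n.
(* Coefficient n depends only on the first n + 1 factors, and no part of a partition of n exceeds
   n. *)
have p1 : eqm 1 (\prod_(i < n.+1) dp_factor i) 1.
  exact: eqm_trans (eqm_sym (eqm_iprod pu (ltn0Sn n))) u1.
have [V EV] := fps_unit p1.
have [r [Ur mem_r E]] := finite_dp_gf n EV.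
have -> : W`[n] = V`[n].
  apply: (@eqm_mulI n.+1 _ p1) => //; rewrite EV -[X in eqm _ _ X]EW.
  by apply: eqmM => //; exact: eqm_sym (eqm_iprod pu (leqnn n.+1)).
rewrite E /= (@dp_size n r) // => s; rewrite mem_r /bounded_dp /in_mem /= /bounded_dp.
case part_s: (is_dp_partition n s) => //=.
have /andP[/partition_bounds/andP[_ le_s] _] := part_s.
by apply: sub_all le_s => x /= /ltnW.
Qed.

Lemma up_poch m x z : small x -> small z ->
  up m.+1 (poch x z) = poch (up m.+1 x) (up m.+1 z).
Proof.
move=> x0 z0; rewrite [LHS](up_iprod _ (poch_prodable x0 z0)); apply: eq_iprod => i.
by rewrite rmorphB rmorph1 rmorphM rmorphXn.
Qed.

Lemma up_euler m z : small z -> up m.+1 (euler z) = euler (up m.+1 z).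
Proof. by move=> z0; apply: up_poch. Qed.

Lemma summable_theta_terms x y : small x -> small y ->
  summable (fun i => x ^+ 'C(i.+1, 2) * (y ^+ 'C(i, 2) + y ^+ 'C(i.+2, 2))).
Proof.
move=> x0 y0 i; apply: eqm0Ml; apply: eqmW (@eqm0X 'C(i.+1, 2) _ x0).
by rewrite bin2S leq_addl.
Qed.

Lemma up_theta m x y : small x -> small y ->
  up m.+1 (theta x y) = theta (up m.+1 x) (up m.+1 y).
Proof.
move=> x0 y0; rewrite [LHS](up_isum _ (summable_theta_terms x0 y0)); apply: eq_isum => i.
by rewrite rmorphM rmorphD !rmorphXn.
Qed.

Lemma up_psi m z : small z -> up m.+1 (psi z) = psi (up m.+1 z).
Proof. by move=> z0; rewrite /psi up_theta ?rmorphXn //; apply: smallX. Qed.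

Lemma exprN_odd (x : fps) n : odd n -> (- x) ^+ n = - x ^+ n.
Proof. by move=> odd_n; rewrite exprNn -signr_odd odd_n expr1 mulN1r. Qed.
Lemma exprN_even (x : fps) n : ~~ odd n -> (- x) ^+ n = x ^+ n.
Proof. by move=> /negPf odd_n; rewrite exprNn -signr_odd odd_n mul1r. Qed.

Lemma iprod_dp_factor :
  iprod dp_factor = poch (- q) (q ^+ 6) * poch (- q ^+ 5) (q ^+ 6) * euler (q ^+ 4).
Proof.
(* Multiples of 4 are even and numbers congruent to 1 or 5 modulo 6 are odd, so each factor
   separates into two, at most one of them different from 1. *)
pose a i : fps := if ((i.+1 %% 6 == 1) || (i.+1 %% 6 == 5))%N then 1 - (- q) ^+ i.+1 else 1.
pose b i : fps := if (4 %| i.+1)%N then 1 - q ^+ i.+1 else 1.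
have pa : prodable a.
  move=> i; rewrite /a; case: ifP => // _; apply: eqm_sub1.
  exact/eqm0X/smallN/small_q.
have pb : prodable b.
  by move=> i; rewrite /b; case: ifP => // _; apply/eqm_sub1/eqm0X/small_q.
transitivity (iprod (fun i => a i * b i)).
  apply: eq_iprod => i; rewrite /dp_factor /dp_part /a /b.
  rewrite [(1 %% 6)%N]/= [(5 %% 6)%N]/=.
  have [d4|nd4] := boolP (4 %| i.+1)%N => /=; last by rewrite mulr1.
  rewrite (_ : _ || _ = false) ?mul1r; last by lia.
  by rewrite exprNn -signr_odd (_ : odd _ = false) ?mul1r //; lia.
have aE i : a i = if ((i.+1 %% 6 == 1) || (i.+1 %% 6 == 5))%N then 1 - (- q) ^+ i.+1 else 1 by [].
have bE i : b i = if (4 %| i.+1)%N then 1 - q ^+ i.+1 else 1 by [].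
clearbody a b; rewrite iprodM // (iprod_split 5 pa) (iprod_split 3 pb).
rewrite !big_ord_recr !big_ord0 /= !mul1r; congr (_ * _).
  rewrite [iprod (fun i => a (i * 6 + 1)%N)]iprod1; last by move=> i; rewrite aE ifF //; lia.
  rewrite [iprod (fun i => a (i * 6 + 2)%N)]iprod1; last by move=> i; rewrite aE ifF //; lia.
  rewrite [iprod (fun i => a (i * 6 + 3)%N)]iprod1; last by move=> i; rewrite aE ifF //; lia.
  rewrite [iprod (fun i => a (i * 6 + 5)%N)]iprod1; last by move=> i; rewrite aE ifF //; lia.
  rewrite !mulr1; congr (_ * _); apply: eq_iprod => i; (rewrite aE ifT; last by lia).
    rewrite exprN_odd; last by lia.
    by rewrite mulNr -exprM -exprS (_ : (i * 6 + 0).+1 = (6 * i).+1)%N //; lia.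
  rewrite exprN_odd; last by lia.
  by rewrite mulNr -exprM -exprD (_ : (i * 6 + 4).+1 = 5 + 6 * i)%N //; lia.
rewrite [iprod (fun i => b (i * 4 + 0)%N)]iprod1; last by move=> i; rewrite bE ifF //; lia.
rewrite [iprod (fun i => b (i * 4 + 1)%N)]iprod1; last by move=> i; rewrite bE ifF //; lia.
rewrite [iprod (fun i => b (i * 4 + 2)%N)]iprod1; last by move=> i; rewrite bE ifF //; lia.
rewrite !mul1r; apply: eq_iprod => i; (rewrite bE ifT; last by lia).
by rewrite -exprM -exprD (_ : (i * 4 + 3).+1 = 4 + 4 * i)%N //; lia.
Qed.

Lemma small_qX k : (0 < k)%N -> small (q ^+ k).
Proof. exact: smallX small_q. Qed.

(** Here psi(q) = (-q; q^2) f_4, and (-q; q^2) splits modulo 6 into three products. All cancel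
    against the factors of dp except (-q^3; q^6), a series in q^3. *)
Lemma dp_gf_psi : dp_gf * psi q = up 3 (poch (- q) (q ^+ 2)).
Proof.
have q2 : small (q ^+ 2) by apply: small_qX.
rewrite up_poch ?up_q //; last exact/smallN/small_q.
rewrite rmorphN rmorphXn /= !up_q -exprM (psiE small_q) (poch_split3 (smallN small_q) q2).
rewrite !mulNr -!exprM -exprS -exprS mulrC -[RHS]mul1r -dp_gfE iprod_dp_factor.
move: (poch (- q) _) (poch (- q ^+ 3) _) (poch (- q ^+ 5) _) (euler _) dp_gf => a b c d e.
ring.
Qed.

(** * Dissections of psi(q) modulo 3 and of theta(-q) modulo 2 *)

Lemma bin2_double n : ('C(n, 2) * 2 + n = n * n)%N.
Proof. by elim: n => // n IHn; rewrite bin2S; nia. Qed.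

Lemma summable_tri z : small z -> summable (fun j => z ^+ 'C(j.+1, 2)).
Proof.
by move=> z0 j; apply: eqmW (@eqm0X 'C(j.+1, 2) _ z0); rewrite bin2S leq_addl.
Qed.

(** The two exponents paired in [theta] are the triangular numbers of index 2i and 2i + 1. *)
Lemma psi_tri z : small z -> psi z = isum (fun j => z ^+ 'C(j.+1, 2)).
Proof.
move=> z0; rewrite (isum_split 1 (summable_tri z0)) !big_ord_recr big_ord0 /= add0r -isumD.
apply: eq_isum => i; rewrite mulrDr -!exprM -!exprD; have Ei := bin2_double i.
  congr (z ^+ _ + z ^+ _).
  by have := bin2_double (i * 2 + 0); rewrite !bin2S; nia.
by have := bin2_double (i * 2 + 1); rewrite !bin2S; nia.
Qed.

(** Triangular numbers of index 3i and 3i + 2 are divisible by 3; that of index 3i + 1 is 9 times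
    the i-th one, plus 1. *)
Lemma psi_dissection3 : psi q = up 3 (theta (q ^+ 2) q) + q * up 3 (psi (q ^+ 3)).
Proof.
have q3 : small (q ^+ 3) by apply: small_qX.
rewrite up_theta ?up_psi //; try exact: small_qX; last exact: small_q.
rewrite !rmorphXn /= !up_q -!exprM psi_tri; last exact: small_q.
rewrite psi_tri; last exact: small_qX.
rewrite (isumMl _ (summable_tri (@small_qX 9 isT))).
rewrite (isum_split 2 (summable_tri small_q)) !big_ord_recr big_ord0 /= add0r.
rewrite addrAC -isumD; congr (_ + _); apply: eq_isum => i; have Ei := bin2_double i.
  rewrite mulrDr -!exprM -!exprD; congr (q ^+ _ + q ^+ _).
    by have := bin2_double (i * 3 + 0); rewrite !bin2S; nia.
  by have := bin2_double (i * 3 + 2); rewrite !bin2S; nia.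
rewrite -exprM -exprS; congr (q ^+ _).
by have := bin2_double (i * 3 + 1); rewrite !bin2S; nia.
Qed.

(** An odd square is 8 T + 1 with T triangular; it comes from two opposite integers, with sign -1.
    The even part e is left unspecified because [sec 2 1] discards it. *)
Lemma theta_minus_dissection2 : exists e,
  theta (- q) (- q) = up 2 e - 2 * (q * up 2 (psi (q ^+ 4))).
Proof.
pose v i := q ^+ (2 * i ^ 2) + q ^+ (2 * i.+1 ^ 2).
have sv : summable v.
  move=> i; rewrite -[0]addr0.
  apply: eqmD; first by apply: eqmW (@eqm0X (2 * i ^ 2) _ small_q); nia.
  by apply: eqmW (@eqm0X (2 * i.+1 ^ 2) _ small_q); nia.
exists (isum v); have nq := smallN small_q; have q8 : small (q ^+ 8) by apply: small_qX.
rewrite up_isum // up_psi; last exact: small_qX.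
rewrite rmorphXn /= up_q -exprM psi_tri // mulrA -mulNr.
rewrite (isumMl _ (summable_tri q8)) -isumD.
rewrite [theta _ _](isum_split 1 (summable_theta_terms nq nq)).
rewrite !big_ord_recr big_ord0 /= add0r -isumD.
apply: eq_isum => i; rewrite /v !mulrDr -!exprD.
have Ei := bin2_double i.
have E0 := bin2_double (i * 2 + 0); have E1 := bin2_double (i * 2 + 1).
rewrite exprN_even; last by move: E0; rewrite !bin2S; nia.
rewrite exprN_odd; last by move: E0; rewrite !bin2S; nia.
rewrite exprN_odd; last by move: E1; rewrite !bin2S; nia.
rewrite exprN_even; last by move: E1; rewrite !bin2S; nia.
rewrite rmorphD !rmorphXn /= up_q -!exprM.
rewrite (_ : ('C((i * 2 + 0).+1, 2) + _ = 2 * (2 * i ^ 2))%N); last by rewrite !bin2S; nia.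
rewrite (_ : ('C((i * 2 + 0).+1, 2) + _ = (8 * 'C(i.+1, 2)).+1)%N); last by rewrite !bin2S; nia.
rewrite (_ : ('C((i * 2 + 1).+1, 2) + _ = (8 * 'C(i.+1, 2)).+1)%N); last by rewrite !bin2S; nia.
rewrite (_ : ('C((i * 2 + 1).+1, 2) + _ = 2 * (2 * i.+1 ^ 2))%N); last by rewrite !bin2S; nia.
rewrite exprS; move: (q ^+ (2 * (2 * i ^ 2))) (q ^+ (2 * (2 * i.+1 ^ 2))) (q ^+ (8 * _)) => a b c.
ring.
Qed.

(** * Trisection and reduction modulo 4 *)

Lemma sec_mul_up m r f g : (r <= m)%N ->
  sec m.+1 r (f * up m.+1 g) = sec m.+1 r f * g.
Proof.
move=> le_rm; have lt_r : (r < m.+1)%N by [].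
rewrite {1}(up_sec m f) mulr_suml raddf_sum (bigD1 (Ordinal lt_r)) //= big1 ?addr0.
  by rewrite -mulrA -rmorphM sec_qX_up // eqxx.
move=> s neq_s; rewrite -mulrA -rmorphM sec_qX_up // ifN //.
by apply: contraNneq neq_s => Ers; apply/eqP/val_inj.
Qed.

(** Coordinates of Z[[q]] as a free module over Z[[q^3]] with basis 1, q, q^2. *)
Definition join3 a b c := up 3 a + q * up 3 b + q ^+ 2 * up 3 c.

Lemma join3_sec f : f = join3 (sec 3 0 f) (sec 3 1 f) (sec 3 2 f).
Proof. by rewrite {1}(up_sec 2 f) !big_ord_recr big_ord0 /= add0r mul1r. Qed.

Lemma sec_join3 a b c :
  [/\ sec 3 0 (join3 a b c) = a, sec 3 1 (join3 a b c) = b & sec 3 2 (join3 a b c) = c].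
Proof.
have -> : join3 a b c = q ^+ 0 * up 3 a + q ^+ 1 * up 3 b + q ^+ 2 * up 3 c.
  by rewrite expr0 mul1r.
by split; rewrite !raddfD /= !sec_qX_up //= ?addr0 ?add0r.
Qed.

Lemma join3M a b c a' b' c' : join3 a b c * join3 a' b' c' =
  join3 (a * a' + q * (b * c' + c * b')) (a * b' + b * a' + q * (c * c'))
        (a * c' + b * b' + c * a').
Proof.
rewrite /join3 !rmorphD !rmorphM /= up_q !rmorphD !rmorphM /=.
move: (up 3 a) (up 3 b) (up 3 c) (up 3 a') (up 3 b') (up 3 c').
by move=> {}a {}b {}c {}a' {}b' {}c'; ring.
Qed.

(* The norm from Z[[q]] to Z[[q^3]], that is f(q) f(w q) f(w^2 q) with w^3 = 1,
   written as a series in q^3 and then read through q^3 -> q. *)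
Definition norm3 f :=
  let a := sec 3 0 f in let b := sec 3 1 f in let c := sec 3 2 f in
  a ^+ 3 + q * b ^+ 3 + q ^+ 2 * c ^+ 3 - 3 * q * a * b * c.

Lemma norm3_join a b c :
  norm3 (join3 a b c) = a ^+ 3 + q * b ^+ 3 + q ^+ 2 * c ^+ 3 - 3 * q * a * b * c.
Proof. by rewrite /norm3; have [-> -> ->] := sec_join3 a b c. Qed.

Lemma norm3M f g : norm3 (f * g) = norm3 f * norm3 g.
Proof.
rewrite (join3_sec f) (join3_sec g) join3M !norm3_join.
move: (sec 3 0 f) (sec 3 1 f) (sec 3 2 f) (sec 3 0 g) (sec 3 1 g) (sec 3 2 g) => a b c a' b' c'.
ring.
Qed.

Lemma norm3_up f : norm3 (up 3 f) = f ^+ 3.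
Proof.
have -> : up 3 f = join3 f 0 0 by rewrite /join3 !rmorph0 !mulr0 !addr0.
by rewrite norm3_join; ring.
Qed.

Lemma norm3_1 : norm3 1 = 1.
Proof. by have := norm3_up 1; rewrite rmorph1 expr1n. Qed.

Lemma eqm_norm3 n f g : eqm (n * 3) f g -> eqm n (norm3 f) (norm3 g).
Proof.
move=> fg; have secE r : (r < 3)%N -> eqm n (sec 3 r f) (sec 3 r g).
  by move=> lt_r3 i lt_in; apply: fg; lia.
have E0 := secE 0%N isT; have E1 := secE 1%N isT; have E2 := secE 2%N isT.
rewrite /norm3 -!mulNr; by do ![apply: eqmD | apply: eqmM | apply: eqmX] => //.
Qed.

Lemma norm3_iprod u : prodable u -> prodable (norm3 \o u) ->
  norm3 (iprod u) = iprod (norm3 \o u).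
Proof.
(* To fix n coefficients of the norm, 3n factors are taken, since the norm is read through q^3 ->
   q. *)
move=> pu pnu; apply: iprod_lim => // n; exists (n * 3)%N; first by lia.
rewrite -(big_morph norm3 norm3M norm3_1); apply: eqm_norm3.
exact: eqm_iprod.
Qed.

(** For n prime to 3 the conjugates of 1 - q^n multiply to 1 - q^(3n), which is read as 1 - q^n. *)
Lemma norm3_sub1X n : ~~ (3 %| n)%N -> norm3 (1 - q ^+ n) = 1 - q ^+ n.
Proof.
move=> ndvd; have lt_r := ltn_pmod n (isT : 0 < 3)%N.
have upE k : up 3 (- q ^+ k) = - (q ^+ (k * 3)).
  by rewrite rmorphN rmorphXn /= up_q -exprM mulnC.
have [E|E] : (n = (n %/ 3) * 3 + 1 \/ n = (n %/ 3) * 3 + 2)%N by lia.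
  have Ej : 1 - q ^+ n = join3 1 (- q ^+ (n %/ 3)) 0.
    by rewrite /join3 rmorph1 rmorph0 upE mulr0 addr0 mulrN -exprS -addn1 -E.
  rewrite [in LHS]Ej norm3_join.
  have -> : q ^+ n = q * q ^+ (n %/ 3) ^+ 3 by rewrite {1}E addn1 exprS exprM.
  by ring.
have Ej : 1 - q ^+ n = join3 1 0 (- q ^+ (n %/ 3)).
  by rewrite /join3 rmorph1 rmorph0 upE mulr0 addr0 mulrN -exprD addnC -E.
rewrite [in LHS]Ej norm3_join.
have -> : q ^+ n = q ^+ 2 * q ^+ (n %/ 3) ^+ 3 by rewrite {1}E addnC exprD exprM.
by ring.
Qed.

Lemma norm3_poch k l : (0 < k)%N -> (0 < l)%N -> ~~ (3 %| k)%N -> (3 %| l)%N ->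
  norm3 (poch (q ^+ k) (q ^+ l)) = poch (q ^+ k) (q ^+ l).
Proof.
move=> k0 l0 nk dl.
have pu := poch_prodable (small_qX k0) (small_qX l0).
have E i : norm3 (1 - q ^+ k * q ^+ l ^+ i) = 1 - q ^+ k * q ^+ l ^+ i.
  by rewrite -exprM -exprD norm3_sub1X // dvdn_addl // dvdn_mulr.
rewrite [LHS](norm3_iprod pu); first by apply: eq_iprod => i /=; rewrite E.
by move=> i; rewrite /= E; apply: pu.
Qed.

(** In f_k the factors of index prime to 3 contribute f_k / f_3k to the norm, and the others form
    f_3k, a series in q^3 whose norm is f_k^3. *)
Lemma norm3_euler k : (0 < k)%N -> ~~ (3 %| k)%N ->
  norm3 (euler (q ^+ k)) * euler (q ^+ (3 * k)) = euler (q ^+ k) ^+ 4.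
Proof.
move=> k0 nk; have qk := small_qX k0.
have Es : euler (q ^+ k) = poch (q ^+ k) (q ^+ (3 * k)) * poch (q ^+ (2 * k)) (q ^+ (3 * k))
    * euler (q ^+ (3 * k)).
  rewrite {1}/euler (poch_split3 qk qk) -!exprM -!exprD /euler.
  by rewrite mulnC [(2 * k)%N]mulSn mul1n [(3 * k)%N]mulSn [(2 * k)%N]mulnC.
have Eu : euler (q ^+ (3 * k)) = up 3 (euler (q ^+ k)).
  by rewrite up_euler // rmorphXn /= up_q -exprM.
have nk2 : ~~ (3 %| 2 * k)%N by rewrite Euclid_dvdM.
have -> : norm3 (euler (q ^+ k)) =
    poch (q ^+ k) (q ^+ (3 * k)) * poch (q ^+ (2 * k)) (q ^+ (3 * k)) * euler (q ^+ k) ^+ 3.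
  rewrite {1}Es !norm3M Eu norm3_up.
  have [k2 k3] : (0 < 2 * k)%N /\ (0 < 3 * k)%N by lia.
  have d3 : (3 %| 3 * k)%N by apply: dvdn_mulr.
  by rewrite (norm3_poch k0 k3 nk d3) (norm3_poch k2 k3 nk2 d3).
by rewrite [RHS]exprS {2}Es mulrAC.
Qed.

(** * The generating function of dp(6n+4) *)

Definition dp6n4_gf := Fps (fun n => (dp (6 * n + 4))%:R).

Lemma sec_dp6n4_gf : sec 2 1 (sec 3 1 dp_gf) = dp6n4_gf.
Proof.
apply: fpsP => n; rewrite /= (_ : ((n * 2 + 1) * 3 + 1 = 6 * n + 4)%N); last by lia.
by rewrite -signr_odd (_ : odd _ = false) ?mul1r //; lia.
Qed.

Lemma dp3n1_gfE : sec 3 1 dp_gf * euler (q ^+ 2) ^+ 4 * euler (q ^+ 4)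
  = - theta (- q) (- q) * euler (q ^+ 6) ^+ 3.
Proof.
set g0 := sec 3 0 dp_gf; set g1 := sec 3 1 dp_gf; set g2 := sec 3 2 dp_gf.
set A := theta (q ^+ 2) q; set P := psi (q ^+ 3); set C := poch (- q) (q ^+ 2).
have psiJ : psi q = join3 A P 0 by rewrite /join3 rmorph0 mulr0 addr0 psi_dissection3.
(* The three coordinates of G psi = C(q^3). *)
have [E0 E1 E2] : [/\ g0 * A + q * (g2 * P) = C, g1 * A + g0 * P = 0 & g2 * A + g1 * P = 0].
  have : join3 g0 g1 g2 * join3 A P 0 = join3 C 0 0.
    by rewrite -join3_sec -psiJ dp_gf_psi /join3 !rmorph0 !mulr0 !addr0.
  rewrite join3M => E.
  have [c0 c1 c2] := sec_join3 C 0 0; rewrite -E in c0 c1 c2.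
  have [a0 a1 a2] := sec_join3 (g0 * A + q * (g1 * 0 + g2 * P))
    (g0 * P + g1 * A + q * (g2 * 0)) (g0 * 0 + g1 * P + g2 * A).
  by split; [rewrite -c0 a0 | rewrite -c1 a1 | rewrite -c2 a2]; ring.
(* Cramer's rule: with A and P taken at q^3, the other two conjugates of psi multiply to A^2 - q A P
   + q^2 P^2, whose coordinate at q is -A P. *)
have ED : g1 * norm3 (psi q) = - (A * P * C).
  rewrite psiJ norm3_join -E0.
  transitivity (A ^+ 2 * (g1 * A + g0 * P) - A * P * (g0 * A + q * (g2 * P))
    + q * P ^+ 2 * (g2 * A + g1 * P)).
    by ring.
  by rewrite E1 E2; ring.
have q1 := small_q; have q2 := @small_qX 2 isT; have q3 := @small_qX 3 isT.
have J1 := psi_euler q1; have J1' := psi_euler q3.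
have J2 := theta_cubic q1; have J3 := theta_minus_euler q1; have J4 := poch_odd_euler q1.
have N1 := @norm3_euler 1 isT isT; have N2 := @norm3_euler 2 isT isT.
move/(congr1 norm3): J1; rewrite expr2 !norm3M => NJ.
move: N1 N2 J1' J2 J3 J4 NJ; rewrite -!exprM ?expr1 -/A -/P -/C.
have u k : (0 < k)%N -> eqm 1 (euler (q ^+ k)) 1.
  by move=> k0; apply: poch_small1; apply: small_qX.
have [u1 u2 u3 u4 u6] :
  [/\ eqm 1 (euler q) 1, eqm 1 (euler (q ^+ 2)) 1, eqm 1 (euler (q ^+ 3)) 1,
      eqm 1 (euler (q ^+ 4)) 1 & eqm 1 (euler (q ^+ 6)) 1].
  by rewrite -{1}(expr1 q); split; apply: u.
rewrite [(3 * 1)%N]/= [(3 * 2)%N]/=.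
(* A unit chosen to supply every denominator in the substitutions below. *)
have uU : eqm 1 (euler (q ^+ 2) ^+ 4 * euler (q ^+ 3) ^+ 2 * euler q ^+ 2 * euler (q ^+ 6)) 1.
  rewrite -[1 in X in eqm _ _ X](_ : 1 ^+ 4 * 1 ^+ 2 * 1 ^+ 2 * 1 = 1); last by ring.
  by do ![apply: eqmM | apply: eqmX].
move=> N1 N2 J1 J2 J3 J4 NJ; apply: (fps_mulI uU).
move: (theta (- q) (- q)) (euler q) (euler (q ^+ 2)) (euler (q ^+ 3)) (euler (q ^+ 4))
  (euler (q ^+ 6)) (norm3 (psi q)) ED {u u1 u2 u3 u4 u6 uU} N1 N2 J1 J2 J3 J4 NJ.
move: g1 A P C {g0 g2 psiJ E0 E1 E2 q1 q2 q3} => g A P C.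
move=> phi f1 f2 f3 f4 f6 D; move: (norm3 f1) (norm3 f2) => n1 n2 ED N1 N2 J1 J2 J3 J4 NJ.
(* The values substituted are N(psi) = f_2^8 f_3 / (f_1^4 f_6^2), A = f_2 f_3^2 / (f_1 f_6), P =
   f_6^2 / f_3, C = f_2^2 / (f_1 f_4) and theta(-q) = f_1^2 / f_2. *)
transitivity (g * f2 ^+ 4 * f2 ^+ 4 * (f1 ^+ 2 * f3 ^+ 2 * f4 * f6)); first ring.
rewrite -[in LHS]N2; transitivity (g * (n2 * n2) * (f1 ^+ 2 * f3 ^+ 2 * f4 * f6 ^+ 3)); first ring.
rewrite -[in LHS]NJ; transitivity (g * D * (n1 * f3) * (f1 ^+ 2 * f3 * f4 * f6 ^+ 3)); first ring.
rewrite ED [in LHS]N1.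
transitivity (- ((A * f1 * f6) * (P * f3) * (C * f1 * f4) * f1 ^+ 2 * f6 ^+ 2 * f1 * f1)); first ring.
by rewrite J1 J2 J4 -[in LHS]J3; ring.
Qed.

(** In [dp3n1_gfE] every known factor except theta(-q) is a series in q^2, so extracting odd
    exponents acts on theta(-q) alone. *)
Lemma dp6n4_gfE :
  dp6n4_gf * (euler q ^+ 4 * euler (q ^+ 2)) = 2 * psi (q ^+ 4) * euler (q ^+ 3) ^+ 3.
Proof.
have [e phiE] := theta_minus_dissection2.
have upE k : (0 < k)%N -> euler (q ^+ (2 * k)) = up 2 (euler (q ^+ k)).
  by move=> k0; rewrite up_euler ?rmorphXn /= ?up_q -?exprM //; apply: small_qX.
have E := dp3n1_gfE; rewrite -mulrA in E.
rewrite (upE 1%N isT) (upE 2%N isT) (upE 3%N isT) expr1 -!rmorphXn -rmorphM in E.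
move/(congr1 (sec 2 1)): E; rewrite !sec_mul_up // sec_dp6n4_gf => ->; congr (_ * _).
rewrite phiE; set x := psi _.
have -> : - (up 2 e - 2 * (q * up 2 x)) = q ^+ 0 * up 2 (- e) + q ^+ 1 * up 2 (2 * x).
  by rewrite rmorphN rmorphM rmorph_nat; ring.
by rewrite raddfD /= !sec_qX_up //= add0r.
Qed.

(** * Reduction modulo 2 and modulo 4 *)

Definition eq2 (f g : fps) := exists h, f = g + 2 * h.

Lemma eq2_refl f : eq2 f f.
Proof. by exists 0; rewrite mulr0 addr0. Qed.
Lemma eq2_sym f g : eq2 f g -> eq2 g f.
Proof. by case=> h ->; exists (- h); ring. Qed.
Lemma eq2_trans f g h : eq2 f g -> eq2 g h -> eq2 f h.
Proof. by case=> x -> [y ->]; exists (y + x); ring. Qed.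
Lemma eq2M f g f' g' : eq2 f f' -> eq2 g g' -> eq2 (f * g) (f' * g').
Proof. by case=> x -> [y ->]; exists (x * g' + f' * y + 2 * x * y); ring. Qed.
Lemma eq2_coef f g : eq2 f g <-> forall n, (2 %| f`[n] - g`[n])%Z.
Proof.
split=> [[h ->] n|E].
  by rewrite fcoefD addrAC subrr add0r (_ : 2 * h = h + h) ?fcoefD; [lia | ring].
pose h := Fps (fun n => ((f`[n] - g`[n]) %/ 2)%Z); exists h; apply: fpsP => n.
rewrite fcoefD (_ : 2 * h = h + h); last by ring.
by rewrite fcoefD /=; have := E n; lia.
Qed.

(** Factor by factor, (1 - x)^2 = 1 - x^2 + 2 (x^2 - x). *)
Lemma euler_sqr z : small z -> eq2 (euler z ^+ 2) (euler (z ^+ 2)).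
Proof.
move=> z0; have z2 := smallX z0 (ltn0Sn 1).
have p1 := poch_prodable z0 z0.
rewrite expr2 /euler -(iprodM p1 p1); apply/eq2_coef => n /=.
move: n; pose a n := \prod_(i < n.+1) ((1 - z * z ^+ i) * (1 - z * z ^+ i)).
pose b n := \prod_(i < n.+1) (1 - z ^+ 2 * z ^+ 2 ^+ i).
suff E n : eq2 (a n) (b n) by move=> n; move/eq2_coef: (E n); apply.
apply: (big_rec2 eq2) => [|i f g _]; first exact: eq2_refl.
apply: eq2M; exists (z * z ^+ i * (z * z ^+ i) - z * z ^+ i).
by rewrite -exprM mulnC exprM; ring.
Qed.

Lemma eqm1M n f g : eqm n f 1 -> eqm n g 1 -> eqm n (f * g) 1.
Proof. by move=> f1 g1; rewrite -[X in eqm _ _ X]mulr1; apply: eqmM. Qed.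

Lemma eq2_mulI u f g : eqm 1 u 1 -> eq2 (f * u) (g * u) -> eq2 f g.
Proof.
case/fps_unit=> w wu1 E.
rewrite -[f]mulr1 -[g]mulr1 -wu1 ![w * u]mulrC !mulrA.
by apply: eq2M => //; apply: eq2_refl.
Qed.

Lemma dp6n4_gf_mod4 : exists h, dp6n4_gf = 2 * (psi (q ^+ 2) * psi (q ^+ 3)) + 4 * h.
Proof.
have u k : (0 < k)%N -> eqm 1 (euler (q ^+ k)) 1.
  by move=> k0; apply: poch_small1; apply: small_qX.
have sq k : (0 < k)%N -> eq2 (euler (q ^+ k) ^+ 2) (euler (q ^+ (k * 2))).
  by move=> k0; rewrite exprM; apply/euler_sqr/small_qX.
have Jk k : (0 < k)%N -> psi (q ^+ k) * euler (q ^+ k) = euler (q ^+ (k * 2)) ^+ 2.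
  by move=> k0; rewrite exprM; apply/psi_euler/small_qX.
have := dp6n4_gfE.
move: (u 1%N isT) (u 2%N isT) (u 3%N isT) (u 4%N isT).
move: (sq 1%N isT) (sq 2%N isT) (sq 3%N isT) (sq 4%N isT).
move: (Jk 2%N isT) (Jk 3%N isT) (Jk 4%N isT).
rewrite !expr1 [(1 * 2)%N]/= [(2 * 2)%N]/= [(3 * 2)%N]/= [(4 * 2)%N]/=.
move: (euler q) (euler (q ^+ 2)) (euler (q ^+ 3)).
move: (euler (q ^+ 4)) (euler (q ^+ 6)) (euler (q ^+ 8)).
move: (psi (q ^+ 2)) (psi (q ^+ 3)) (psi (q ^+ 4)) dp6n4_gf.
move=> p2 p3 p4 d f4 f6 f8 f1 f2 f3 J2 J3 J4 s1 s2 s3 s4 u1 u2 u3 u4 E.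
(* The generating function already carries a factor 2, so parity is enough. After multiplication by
   f_2 f_3 f_4 both sides are congruent to f_4^4 f_6^2 f_2. *)
have [w Ew] : eq2 (p4 * f3 ^+ 3) (p2 * p3 * (f1 ^+ 4 * f2)).
  have uU : eqm 1 (f2 * f3 * f4) 1.
    by apply: eqm1M => //; apply: eqm1M.
  apply: (eq2_mulI uU).
  have -> : p4 * f3 ^+ 3 * (f2 * f3 * f4) = (f8 * f8) * (f3 ^+ 2 * f3 ^+ 2) * f2.
    by rewrite -expr2 -J4; ring.
  have -> : p2 * p3 * (f1 ^+ 4 * f2) * (f2 * f3 * f4) =
      f4 ^+ 2 * f6 ^+ 2 * (f1 ^+ 2 * f1 ^+ 2) * (f2 * f4).
    by rewrite -J2 -J3; ring.
  apply: (@eq2_trans _ ((f4 ^+ 2 * f4 ^+ 2) * (f6 * f6) * f2)).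
    by do 2?apply: eq2M; try apply: eq2M; first [exact: eq2_sym s4 | exact: s3 | exact: eq2_refl].
  rewrite (_ : _ * _ * f2 = f4 ^+ 2 * f6 ^+ 2 * (f4 * (f4 * f2))); last by ring.
  rewrite (_ : _ * _ * (f2 * f4) = f4 ^+ 2 * f6 ^+ 2 * (f1 ^+ 2 * f1 ^+ 2 * (f4 * f2)));
    last by ring.
  apply: eq2M; first exact: eq2_refl.
  apply: eq2M; last exact: eq2_refl.
  apply: eq2_sym; apply: (@eq2_trans _ (f2 * f2)); first exact: eq2M.
  by rewrite -expr2.
have [v uv1] : exists v, v * (f1 ^+ 4 * f2) = 1.
  by apply: fps_unit; apply: eqm1M => //; rewrite -(expr1n _ 4); apply: eqmX.
exists (w * v); rewrite -[d]mulr1 -uv1 mulrCA E.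
transitivity (2 * p2 * p3 * (v * (f1 ^+ 4 * f2)) + 4 * (w * v)); last by rewrite uv1; ring.
by rewrite -mulrA Ew; ring.
Qed.

Lemma fcoef_qX k n : (q ^+ k)`[n] = (n == k)%:R.
Proof.
rewrite -[q ^+ k]mulr1 fcoef_qXM fcoef1; case: ltnP => H; [case: eqP => //; lia|].
by congr (nat_of_bool _)%:R; apply/eqP/eqP; lia.
Qed.

Lemma psi_coef k n : (0 < k)%N -> (psi (q ^+ k))`[n] != 0 ->
  exists i, n = (k * 'C(i.+1, 2))%N.
Proof.
move=> k0; rewrite psi_tri; last exact: small_qX.
rewrite [coef _ _]/= fcoef_sum => nz.
have [i Ei|none] := pickP (fun i : 'I_n.+1 => n == (k * 'C(i.+1, 2))%N).
  by exists i; apply/eqP.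
by case/eqP: nz; apply: big1 => i _; rewrite -exprM fcoef_qX none.
Qed.

(** An odd coefficient of psi(q^2) psi(q^3) needs n = 2 T + 3 T' with T, T' triangular; since 8 T +
    1 is a square, 8n + 5 has the form stated. *)
Lemma dp_mod4_rep n : dp (6 * n + 4) != 0 %[mod 4] ->
  exists a b, (8 * n + 5 = 2 * a ^ 2 + 3 * b ^ 2)%N.
Proof.
have [h /(congr1 (fun f => f`[n]))] := dp6n4_gf_mod4.
rewrite [LHS]/=; set K := psi _ * psi _ => E nz.
have {}E : (dp (6 * n + 4))%:R = 2 * K`[n] + 4 * h`[n] :> int.
  rewrite E (_ : 2 * K + 4 * h = K + K + (h + h + (h + h))); last by ring.
  by rewrite !fcoefD; ring.
have : K`[n] != 0.
  by apply: contraNneq nz => K0; move: E; rewrite K0; lia.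
rewrite [coef _ _]/= => nzK.
have [i|none] := pickP (fun i : 'I_n.+1 => (psi (q ^+ 2))`[i] * (psi (q ^+ 3))`[n - i] != 0).
  rewrite mulf_eq0 negb_or => /andP[/psi_coef-/(_ isT)[x Ex] /psi_coef-/(_ isT)[y Ey]].
  have le_in := ltn_ord i; exists (2 * x + 1)%N, (2 * y + 1)%N.
  by have := bin2_double x; have := bin2_double y; move: Ex Ey; rewrite !bin2S; nia.
by case/eqP: nzK; apply: big1 => i _; apply/eqP/negbFE/none.
Qed.

(** * The form 2 a^2 + 3 b^2 modulo p *)

(** The unit group is cyclic, so it has an element of order 8; its fourth power is a square root of
    1 other than 1. *)
Lemma exists_expr4_eqN1 (F : finFieldType) : (8 %| #|F|.-1)%N -> exists z : F, z ^+ 4 = -1.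
Proof.
move=> d8; have /cyclicP[g Eg] := field_unit_group_cyclic [set: {unit F}]%G.
have og : #[g]%g = #|F|.-1 by rewrite orderE -Eg card_finField_unit.
have N0 : (0 < #|F|.-1)%N by rewrite -og order_gt0.
pose w := (g ^+ (#|F|.-1 %/ 8))%g.
have ow : #[w]%g = 8%N.
  rewrite /w orderXdiv og ?dvdn_div //; case/dvdnP: d8 N0 => k ->.
  by rewrite mulnK // muln_gt0 => /andP[k0 _]; rewrite mulKn.
pose z : F := val w; exists z.
have z8 : z ^+ 8 = 1 by rewrite /z -FinRing.val_unitX -ow expg_order.
have z4 : z ^+ 4 != 1.
  rewrite /z -FinRing.val_unitX -FinRing.val_unit1 (inj_eq val_inj) -order_dvdn ow.
  by [].
have /eqP : z ^+ 8 - 1 = (z ^+ 4 - 1) * (z ^+ 4 + 1) by ring.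
by rewrite z8 subrr eq_sym mulf_eq0 subr_eq0 (negPf z4) addr_eq0 => /eqP.
Qed.

(** If y were nonzero modulo p, -6 would be a square; 2 is one, so -3 would be too, giving a
    primitive cube root of 1 in F_p. The field of p^2 elements is used because it contains the
    eighth roots of 1; lying in F_p is expressed by Frobenius. *)
Lemma form_anisotropic p x y : prime p -> p = 17 %[mod 24] \/ p = 23 %[mod 24] ->
  (p %| 2 * x ^ 2 + 3 * y ^ 2)%N -> (p %| x)%N && (p %| y)%N.
Proof.
move=> p_pr p_mod dvd_p.
have [F pF cardF] := pPrimePowerField p_pr (isT : 0 < 2)%N.
have dvdF n : (p %| n)%N = (n%:R == 0 :> F) by rewrite (dvdn_pcharf pF).
have frob n : n%:R ^+ p = n%:R :> F by exact: (pFrobenius_aut_nat pF).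
have p2 : (2%:R : F) != 0 by rewrite -dvdF; apply/negP => /dvdn_leq-/(_ isT); lia.
have p3 : (3%:R : F) != 0 by rewrite -dvdF; apply/negP => /dvdn_leq-/(_ isT); lia.
have [z z4] : exists z : F, z ^+ 4 = -1.
  apply: exists_expr4_eqN1; rewrite cardF.
  have -> : ((p ^ 2).-1 = (p - 1) * (p + 1))%N by have := prime_gt0 p_pr; nia.
  rewrite (_ : 8 = 2 * 4)%N //; case: p_mod => p_mod.
    by rewrite dvdn_mulr //; lia.
  by rewrite dvdn_mull //; lia.
have z0 : z != 0 by apply: contra_eq_neq z4 => ->; rewrite expr0n eq_sym oppr_eq0 oner_neq0.
(* t is a square root of 2 and, below, r is a primitive cube root of 1; both are
   fixed by Frobenius since p = 1, 7 mod 8, which is absurd for r as p = 2 mod 3. *)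
pose t := z + z^-1.
have t2 : t ^+ 2 = 2.
  have : z ^+ 2 * (t ^+ 2 - 2) = 0.
    transitivity (z ^+ 4 + 1); last by rewrite z4 addNr.
    by rewrite /t; field.
  by move/eqP; rewrite mulf_eq0 expf_eq0 (negPf z0) andbF subr_eq0 => /eqP.
have z8 : z ^+ 8 = 1 by rewrite (exprM z 4 2) z4 sqrrN expr1n.
have tp : t ^+ p = t.
  have -> : t ^+ p = z ^+ p + z ^- p.
    by rewrite -(pFrobenius_autE pF) rmorphD /= !pFrobenius_autE exprVn.
  have -> : z ^+ p = z ^+ (p %% 8).
    by rewrite {1}(divn_eq p 8) exprD mulnC exprM z8 expr1n mul1r.
  have [->|->] : (p %% 8 = 1 \/ p %% 8 = 7)%N by lia.
    by rewrite expr1.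
  have -> : z ^+ 7 = z^-1 by apply: (mulfI z0); rewrite -exprS z8 divff.
  by rewrite invrK addrC.
have t0 : t != 0 by apply: contra_eq_neq t2 => ->; rewrite expr0n eq_sym.
move: dvd_p; rewrite !dvdF natrD !natrM => /eqP E.
have [y0|y0] := eqVneq (y%:R : F) 0.
  rewrite andbT; move: E; rewrite y0 !mulr0 addr0 => /eqP.
  by rewrite !mulf_eq0 (negPf p2) orbb.
exfalso.
(* Since (2x)^2 = -6 y^2, dividing by y and by the square root t of 2 gives a square root of -3. *)
pose s := 2 * x%:R / (y%:R * t).
have s2 : s ^+ 2 = - 3.
  rewrite /s exprMn exprVn [(_ * t) ^+ 2]exprMn t2.
  have -> : (2 * x%:R) ^+ 2 = - 3 * 2 * y%:R ^+ 2 :> F.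
    by apply/eqP; rewrite -subr_eq0 -(mulr0 2) -E; apply/eqP; ring.
  by field; rewrite p2.
have sp : s ^+ p = s.
  rewrite -(pFrobenius_autE pF) /s rmorphM fmorphV rmorphM rmorphM /= !pFrobenius_autE.
  by rewrite !frob tp.
pose r := (s - 1) / 2.
have r3 : r ^+ 3 = 1.
  suff : r ^+ 3 - 1 = (s ^+ 2 + 3) * (s - 3) / 2 ^+ 3 by rewrite s2 addNr !mul0r => /subr0_eq.
  by rewrite /r; field; rewrite p2 (natrX F 2 3) expf_neq0.
have r0 : r != 0 by apply: contra_eq_neq r3 => ->; rewrite expr0n eq_sym oner_neq0.
have rp : r ^+ p = r.
  rewrite -(pFrobenius_autE pF) /r rmorphM fmorphV rmorphB rmorph1 /= !pFrobenius_autE.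
  by rewrite sp (frob 2).
have : r ^+ 2 = r.
  rewrite -[RHS]rp (divn_eq p 3) exprD mulnC exprM r3 expr1n mul1r.
  by congr (r ^+ _); lia.
rewrite expr2 -[RHS]mulr1 => /(mulfI r0) r1.
have s3 : s = 3.
  move: (congr1 (fun u => 2 * u + 1) r1); rewrite /r mulrCA divff // => E1.
  by rewrite -[s](subrK 1) -[s - 1]mulr1 E1; ring.
(* With s = 3 the equation s^2 = -3 reads 12 = 0, impossible since 2 and 3 are nonzero in F. *)
have : 2 ^+ 2 * 3 = 0 :> F by move/eqP: s2; rewrite s3 -subr_eq0 opprK => /eqP <-; ring.
by apply/eqP; rewrite mulf_neq0 // expf_neq0.
Qed.

Close Scope ring_scope.

(** Descent: p divides both a and b, so p^2 cancels and k drops by one. For k = 0 the cancellation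
    leaves p dividing 8 m, hence 8, which p exceeds. *)
Lemma odd_valuation_neq_form p k m a b : prime p ->
    p = 17 %[mod 24] \/ p = 23 %[mod 24] -> ~~ (p %| m)%N ->
  (8 * p ^ (2 * k + 1) * m + 5 * p ^ (2 * k + 2) != 2 * a ^ 2 + 3 * b ^ 2)%N.
Proof.
move=> p_pr p_mod ndvd; have p0 := prime_gt0 p_pr.
have fE j : (8 * p ^ (2 * j + 1) * m + 5 * p ^ (2 * j + 2)
    = p * (p ^ (2 * j) * (8 * m + 5 * p)))%N by rewrite !expnD; ring.
elim: k a b => [|k IHk] a b; apply/eqP => E.
  have : (p %| 2 * a ^ 2 + 3 * b ^ 2)%N.
    by rewrite -E fE dvdn_mulr.
  case/(form_anisotropic p_pr p_mod)/andP => /dvdnP[x Ex] /dvdnP[y Ey].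
  have {}E : (8 * m = p * (2 * x ^ 2 + 3 * y ^ 2 - 5))%N.
    have /eqP : (p * (8 * m + 5 * p) = p * (p * (2 * x ^ 2 + 3 * y ^ 2)))%N.
      by transitivity (2 * a ^ 2 + 3 * b ^ 2)%N; [rewrite -E fE; ring | rewrite Ex Ey; ring].
    by rewrite eqn_pmul2l // => /eqP E1; rewrite mulnBr -E1 [(p * 5)%N]mulnC addnK.
  have : (p %| 8 * m)%N by rewrite E dvdn_mulr.
  rewrite (Euclid_dvdM _ _ p_pr) (negPf ndvd) orbF => /dvdn_leq-/(_ isT).
  by lia.
have : (p %| 2 * a ^ 2 + 3 * b ^ 2)%N.
  by rewrite -E fE dvdn_mulr.
case/(form_anisotropic p_pr p_mod)/andP => /dvdnP[x Ex] /dvdnP[y Ey].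
have p20 : (0 < p ^ 2)%N by rewrite expn_gt0 p0.
case/eqP: (IHk x y); apply/eqP; rewrite -(eqn_pmul2l p20); apply/eqP.
transitivity (2 * a ^ 2 + 3 * b ^ 2)%N; last by rewrite Ex Ey; ring.
by rewrite -E !fE mulnS expnD; ring.
Qed.

Theorem theorem1p3 (p : nat) (p_prime : prime p)
    (p_mod : p = 17 %[mod 24] \/ p = 23 %[mod 24])
    (k m : nat) (p_ndiv_m : ~~ (p %| m)) :
  dp (6 * p ^ (2 * k + 1) * m + (15 * p ^ (2 * k + 2) + 1) %/ 4) = 0 %[mod 4].
Proof.
have p2 : (p ^ 2 = 1 %[mod 24])%N.
  by rewrite -mulnn -modnMm; case: p_mod => ->.
(* With p^(2k+2) = 24 t + 1 the quotient by 4 is exact and equals 90 t + 4. The argument of [dp] is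
   then 6 n + 4 for n = p^(2k+1) m + 15 t, and 8 n + 5 = 8 p^(2k+1) m + 5 p^(2k+2). *)
have [t Et] : exists t, (p ^ (2 * k + 2) = 24 * t + 1)%N.
  exists (p ^ (2 * k + 2) %/ 24)%N.
  have : (p ^ (2 * k + 2) %% 24 = 1)%N.
    by rewrite -mulnSr expnM -modnXm p2 modnXm exp1n.
  by have := divn_eq (p ^ (2 * k + 2)) 24; lia.
apply/eqP/negPn/negP => nz.
have [|a [b]] := @dp_mod4_rep (p ^ (2 * k + 1) * m + 15 * t).
  move: nz; rewrite (_ : 6 * p ^ (2 * k + 1) * m + _ = 6 * (p ^ (2 * k + 1) * m + 15 * t) + 4)%N //.
  by rewrite Et; lia.
have := odd_valuation_neq_form k a b p_prime p_mod p_ndiv_m.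
rewrite Et => /eqP no E; apply: no; rewrite -E; lia.
Qed.
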